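(* Let $(W,S)$ be a Coxeter system, let $K\subseteq S$, and suppose that $\mathscr I_0\subseteq W_K$ is a $W_K$-graph ideal with respect to $J\subseteq K$, with corresponding $\mathcal H_K$-module $\mathscr S_0=\mathscr S(\mathscr I_0,J)$. Then $\mathscr I=D_K\mathscr I_0=\{dz\mid d\in D_K,\ z\in\mathscr I_0\}$ is a $W$-graph ideal with respect to $J$, the corresponding $\mathcal H$-module $\mathscr S(\mathscr I,J)$ being isomorphic to $\mathcal H\otimes_{\mathcal H_K}\mathscr S_0$.
   Context: Let $(W,S)$ be a Coxeter system with length function $l$. The Bruhat order $\le$ on $W$ is the transitive closure of the relation $u\to w$ that holds if $l(u)\le l(w)$ and $w=tu$ with $t=1$ or $t$ a conjugate of an element of $S$; the symbols $<,\le$ always refer to it. The left weak order is: $u\le_L w$ if and only if $l(wu^{-1})=l(w)-l(u)$; then $u$ is called a suffix of $w$. $\mathcal A=\mathbb Z[q,q^{-1}]$ and $\mathcal A^+=\mathbb Z[q]$. The Hecke algebra $\mathcal H=\mathcal H(W)$ is the associative $\mathcal A$-algebra generated by $\{T_s\mid s\in S\}$ subject to $T_s^2=1+(q-q^{-1})T_s$ and $T_sT_{s'}T_s\cdots=T_{s'}T_sT_{s'}\cdots$ ($m(s,s')$ factors on each side, $m(s,s')$ the order of $ss'$). The involution $a\mapsto\overline a$ of $\mathcal A$ with $\overline q=q^{-1}$ extends to an involution of $\mathcal H$ with $\overline{T_s}=T_s^{-1}=T_s-(q-q^{-1})$. For $K\subseteq S$, $W_K$ is the subgroup of $W$ generated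 by $K$ ($(W_K,K)$ is a Coxeter system), and $\mathcal H_K=\mathcal H(W_K)$ is identified with the subalgebra of $\mathcal H$ generated by $\{T_s\mid s\in K\}$. For $J\subseteq S$ let $D_J=\{w\in W\mid l(ws)>l(w)\text{ for all }s\in J\}$. Let $\mathscr I$ be an ideal of $(W,\le_L)$ (every suffix of an element of $\mathscr I$ lies in $\mathscr I$) and let $J\subseteq S$ satisfy $\mathscr I\subseteq D_J$. For $w\in\mathscr I$ put $\mathrm{SA}(w)=\{s\in S\mid sw>w,\ sw\in\mathscr I\}$, $\mathrm{SD}(w)=\{s\in S\mid sw<w\}$, $\mathrm{WA}_J(w)=\{s\in S\mid sw>w,\ sw\in D_J\setminus\mathscr I\}$, $\mathrm{WD}_J(w)=\{s\in S\mid sw>w,\ sw\notin D_J\}$. $\mathscr I$ is a $W$-graph ideal with respect to $J$ if: (i) there is an $\mathcal A$-free $\mathcal H$-module $\mathscr S=\mathscr S(\mathscr I,J)$ with an $\mathcal A$-basis $(b_w\mid w\in\mathscr I)$ such that $T_sb_w=b_{sw}$ if $s\in\mathrm{SA}(w)$; $T_sb_w=b_{sw}+(q-q^{-1})b_w$ if $s\in\mathrm{SD}(w)$; $T_sb_w=-q^{-1}b_w$ if $s\in\mathrm{WD}_J(w)$; and $T_sb_w=qb_w-\sum_{y\in\mathscr I,\,y<sw}r^s_{y,w}b_y$ if $s\in\mathrm{WA}_J(w)$, for some polynomials $r^s_{y,w}\in q\mathcal A^+$; (ii) $\mathscr S$ admits an $\mathcal A$-semilinear involution $\alpha\mapsto\overline\alpha$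 with $\overline{b_1}=b_1$ and $\overline{h\alpha}=\overline h\,\overline\alpha$ for all $h\in\mathcal H$, $\alpha\in\mathscr S$. (In particular $1\in\mathscr I$.) The module $\mathscr S(\mathscr I,J)$ is determined up to isomorphism by $\mathscr I$ and $J$. A $W_K$-graph ideal with respect to $J\subseteq K$ is defined by applying the same definition to the Coxeter system $(W_K,K)$ in place of $(W,S)$. *)

(* Defs.v *)
From HB Require Import structures.
From mathcomp Require Import all_boot all_order all_algebra fraction all_fingroup.
From mathcomp Require Import finmap.
From mathcomp Require Import generic_quotient boolp classical_sets fsbigop.

From Stdlib Require Import Relation_Operators.

Set Implicit Arguments.
Unset Strict Implicit.
Unset Printing Implicit Defensive.

Import GRing.Theory.
Local Open Scope classical_set_scope.
Local Open Scope quotient_scope.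
Local Open Scope ring_scope.

Local Notation "x %:F" := (tofrac x).

Definition qfrac : {fraction {poly int}} := ('X : {poly int})%:F.

(* Z[q,q^-1] as the subring of Frac(Z[X]) of the fractions p / X^n, with q = X. *)
Definition laurent_pred : {pred {fraction {poly int}}} :=
  fun x => `[< exists n (p : {poly int}), x = p%:F / qfrac ^+ n >].

Lemma qfrac_neq0 : qfrac != 0.
Proof. by rewrite /qfrac tofrac_eq0 polyX_eq0. Qed.

Lemma laurent_subring : subring_closed laurent_pred.
Proof.
have q0 := qfrac_neq0.
split=> [|x y /asboolP[n [p ->]] /asboolP[m [r ->]]|
          x y /asboolP[n [p ->]] /asboolP[m [r ->]]]; apply/asboolP.
- by exists 0%N, 1; rewrite rmorph1 expr0 divr1.
- exists (n + m)%N, (p * 'X^m - r * 'X^n).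
  rewrite rmorphB !rmorphM !rmorphXn /= -/qfrac exprD.
  by rewrite -!mulNr addf_div ?expf_neq0.
- exists (n + m)%N, (p * r).
  by rewrite rmorphM exprD mulf_div.
Qed.

HB.instance Definition _ := GRing.isSubringClosed.Build _ laurent_pred
  laurent_subring.

Record laurent := Laurent {
  laurent_val : {fraction {poly int}};
  laurent_valP : laurent_val \in laurent_pred }.

HB.instance Definition _ := [isSub for laurent_val].
HB.instance Definition _ := [Choice of laurent by <:].
HB.instance Definition _ := [SubChoice_isSubComNzRing of laurent by <:].

Lemma poly_laurent_subproof (p : {poly int}) : p%:F \in laurent_pred.
Proof. by apply/asboolP; exists 0%N, p; rewrite expr0 divr1. Qed.

Definition poly_laurent (p : {poly int}) : laurent :=
  Laurent (poly_laurent_subproof p).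

Definition q : laurent := poly_laurent 'X.

Lemma qinv_subproof : qfrac^-1 \in laurent_pred.
Proof. by apply/asboolP; exists 1%N, 1; rewrite rmorph1 expr1 div1r. Qed.

Definition qinv : laurent := Laurent qinv_subproof.

(* q Z[q], as a subset of Z[q,q^-1]. *)
Definition qAplus : set laurent :=
  [set a | exists p : {poly int}, a = poly_laurent ('X * p)].

Lemma poly_laurent_zmod : zmod_morphism poly_laurent.
Proof. by move=> x y; apply: val_inj; rewrite /= rmorphB. Qed.
Lemma poly_laurent_monoid : monoid_morphism poly_laurent.
Proof. by split=> [|x y]; apply: val_inj; rewrite /= ?rmorph1 ?rmorphM. Qed.
HB.instance Definition _ :=
  GRing.isZmodMorphism.Build _ _ poly_laurent poly_laurent_zmod.
HB.instance Definition _ :=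
  GRing.isMonoidMorphism.Build _ _ poly_laurent poly_laurent_monoid.

Lemma mulqV : q * qinv = 1.
Proof. by apply: val_inj; rewrite /= -/qfrac mulfV ?qfrac_neq0. Qed.

Lemma laurentP (a : laurent) :
  {np : nat * {poly int} | a * q ^+ np.1 = poly_laurent np.2}.
Proof.
apply: cid; have /asboolP[n [p ap]] := laurent_valP a.
exists (n, p); apply: val_inj.
rewrite (rmorphM val) (rmorphXn val) /= -/qfrac ap.
by rewrite mulfVK // expf_neq0 // qfrac_neq0.
Qed.

Definition subst_qinv (p : {poly int}) : laurent := (map_poly intr p).[qinv].

(* If a q^n = p(q) with p a polynomial, then the conjugate of a is
   p(q^-1) q^n; laurent_barP shows that the choice of (n, p) is irrelevant. *)
Definition laurent_bar (a : laurent) : laurent :=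
  let np := sval (laurentP a) in subst_qinv np.2 * q ^+ np.1.

Fact subst_qinv_zmod : zmod_morphism subst_qinv.
Proof. by move=> x y; rewrite /subst_qinv rmorphB hornerD hornerN. Qed.
Fact subst_qinv_monoid : monoid_morphism subst_qinv.
Proof.
split=> [|x y]; rewrite /subst_qinv; first by rewrite rmorph1 hornerE.
by rewrite rmorphM hornerM.
Qed.
HB.instance Definition _ :=
  GRing.isZmodMorphism.Build _ _ subst_qinv subst_qinv_zmod.
HB.instance Definition _ :=
  GRing.isMonoidMorphism.Build _ _ subst_qinv subst_qinv_monoid.

Lemma subst_qinvX : subst_qinv 'X = qinv.
Proof. by rewrite /subst_qinv map_polyX hornerX. Qed.

Lemma poly_laurent_inj : injective poly_laurent.
Proof.
move=> x y /(congr1 laurent_val)/= /eqP.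
by rewrite tofrac_eq => /eqP.
Qed.

Lemma barP a n p : a * q ^+ n = poly_laurent p ->
  laurent_bar a = subst_qinv p * q ^+ n.
Proof.
rewrite /laurent_bar; case: (laurentP a) => [[m r] /= ar] ap.
have qq k : q ^+ k = poly_laurent 'X^k by rewrite rmorphXn.
have : poly_laurent (r * 'X^n) = poly_laurent (p * 'X^m).
  by rewrite !rmorphM /= -!qq -ar -ap -!mulrA; congr (_ * _); rewrite mulrC.
move=> /poly_laurent_inj/(congr1 subst_qinv).
rewrite !rmorphM !rmorphXn /= subst_qinvX => rp.
have E k : q ^+ k * qinv ^+ k = 1 by rewrite -exprMn mulqV expr1n.
rewrite -[LHS]mulr1 -(E n) [q ^+ n * _]mulrC mulrACA rp.
by rewrite -mulrA [qinv ^+ m * _]mulrA [qinv ^+ m * _]mulrC E mul1r.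
Qed.

Lemma bar_zmod : zmod_morphism laurent_bar.
Proof.
move=> a b; case: (laurentP a) (laurentP b) => [[n p] /= ap] [[m r] /= br].
rewrite (barP ap) (barP br).
rewrite (@barP _ (n + m) (p * 'X^m - r * 'X^n)); last first.
  rewrite rmorphB !rmorphM !rmorphXn /= -/q -ap -br mulrBl exprD.
  by rewrite mulrA [q ^+ n * _]mulrC [b * (_ * _)]mulrA.
have E k : q ^+ k * qinv ^+ k = 1 by rewrite -exprMn mulqV expr1n.
rewrite rmorphB !rmorphM !rmorphXn /= subst_qinvX mulrBl exprD.
congr (_ - _); rewrite -mulrA; congr (_ * _).
  by rewrite mulrCA [_ * q ^+ m]mulrC E mulr1.
by rewrite mulrA [_ * q ^+ n]mulrC E mul1r.
Qed.

Lemma bar_monoid : monoid_morphism laurent_bar.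
Proof.
split.
  by rewrite (@barP _ 0 1) ?expr0 ?mulr1 ?rmorph1.
move=> a b; case: (laurentP a) (laurentP b) => [[n p] /= ap] [[m r] /= br].
rewrite (barP ap) (barP br).
rewrite (@barP _ (n + m) (p * r)); last by rewrite rmorphM /= -ap -br exprD mulrACA.
by rewrite rmorphM exprD mulrACA.
Qed.
HB.instance Definition _ := GRing.isZmodMorphism.Build _ _ laurent_bar bar_zmod.
HB.instance Definition _ := GRing.isMonoidMorphism.Build _ _ laurent_bar bar_monoid.

Lemma bar_q : laurent_bar q = qinv.
Proof. by rewrite (@barP _ 0 'X) ?expr0 ?mulr1 // subst_qinvX. Qed.

Lemma bar_qinv : laurent_bar qinv = q.
Proof.
by rewrite (@barP _ 1 1) ?rmorph1 ?expr1 ?mul1r // mulrC mulqV.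
Qed.

(* A pair (W_S, S) is represented by the subset S of an ambient group W, with
   W_S the subgroup generated by S.  All notions below (length, Bruhat order,
   Hecke algebra, ...) are those of (W_S, S) and do not refer to the ambient
   group, so that for K `<=` S they apply literally to (W_K, K). *)
Section Coxeter.

Context {W : groupType}.
Implicit Types (S J I : set W) (u v w s t : W).

Definition has_order (w : W) (m : nat) : Prop :=
  [/\ (0 < m)%N, (w ^+ m = 1)%g
    & forall k, (0 < k < m)%N -> (w ^+ k <> 1)%g].

Definition word S (a : seq W) : Prop := forall s, s \in a -> S s.

(* Words in S give the whole generated subgroup since the elements of S have
   order 2. *)
Definition gen_subgroup S : set W :=
  [set w | exists2 a, word S a & w = (\prod_(s <- a) s)%g].

(* Equality in the group presented by the generators S and the relations
   (s t)^m(s,t) = 1 for m(s,t) finite; the case s = t gives s s = 1, so no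
   formal inverses are needed. *)
Inductive word_equiv S : seq W -> seq W -> Prop :=
| word_equiv_refl a : word_equiv S a a
| word_equiv_sym a b : word_equiv S a b -> word_equiv S b a
| word_equiv_trans a b c :
    word_equiv S a b -> word_equiv S b c -> word_equiv S a c
| word_equiv_rel a b s t m : S s -> S t -> has_order (s * t)%g m ->
    word_equiv S (a ++ b) (a ++ flatten (nseq m [:: s; t]) ++ b).

Definition coxeter_system S : Prop :=
  [/\ forall s, S s -> has_order s 2,
      gen_subgroup S = setT
    & forall a, word S a -> (\prod_(s <- a) s)%g = 1%g -> word_equiv S a [::]].

Definition expressible S w (n : nat) : bool :=
  `[< exists a, [/\ word S a, size a = n & w = (\prod_(s <- a) s)%g] >].

(* The value 0 outside the subgroup generated by S is a dummy. *)
Definition cox_length S w : nat :=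
  if pselect (exists n, expressible S w n) is left ex then ex_minn ex else 0%N.

Definition bruhat_step S : W -> W -> Prop := fun u w =>
  [/\ gen_subgroup S u, gen_subgroup S w, (cox_length S u <= cox_length S w)%N
    & exists2 t, t = 1%g \/ (exists s x, [/\ S s, gen_subgroup S x & t = (s ^ x)%g])
               & w = (t * u)%g].

Definition bruhat_le S : W -> W -> Prop := clos_trans W (bruhat_step S).

Definition bruhat_lt S u w : Prop := bruhat_le S u w /\ u <> w.

(* The left weak order u <=_L w. *)
Definition suffix_of S u w : Prop :=
  [/\ gen_subgroup S u, gen_subgroup S w
    & (cox_length S (w * u^-1)%g + cox_length S u = cox_length S w)%N].

Definition left_ideal S I : Prop :=
  I `<=` gen_subgroup S /\ forall u w, I w -> suffix_of S u w -> I u.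

(* The set D_J of (W_S, S). *)
Definition min_coset_reps S J : set W :=
  [set w | gen_subgroup S w /\
           forall s, J s -> (cox_length S w < cox_length S (w * s)%g)%N].

Definition strong_ascent S I w : set W :=
  [set s | [/\ S s, bruhat_lt S w (s * w)%g & I (s * w)%g]].
Definition strong_descent S w : set W :=
  [set s | S s /\ bruhat_lt S (s * w)%g w].
Definition weak_ascent S J I w : set W :=
  [set s | [/\ S s, bruhat_lt S w (s * w)%g
             & (min_coset_reps S J `\` I) (s * w)%g]].
Definition weak_descent S J w : set W :=
  [set s | [/\ S s, bruhat_lt S w (s * w)%g
             & ~ min_coset_reps S J (s * w)%g]].

End Coxeter.

(* The alternating product x y x ... with m factors. *)
Fixpoint braid (B : pzRingType) (m : nat) (x y : B) : B :=
  if m is n.+1 then x * braid n y x else 1.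

(* The Hecke algebra is the algebra over laurent presented by generators and
   relations: expressions in the constants and in the generators T_s, modulo
   the congruence generated by the algebra axioms and the defining relations. *)
Inductive hecke_term (X : Type) : Type :=
| HConst of laurent
| HGen of X
| HAdd of hecke_term X & hecke_term X
| HMul of hecke_term X & hecke_term X.
Arguments HConst {X}.
Arguments HGen {X}.

HB.instance Definition _ (X : Type) := gen_eqMixin (hecke_term X).
HB.instance Definition _ (X : Type) := gen_choiceMixin (hecke_term X).

Fixpoint hecke_term_braid (X : Type) (m : nat) (x y : hecke_term X) :=
  if m is n.+1 then HMul x (hecke_term_braid n y x) else HConst 1.

Section Hecke.

Context {W : groupType} (S : set W).
Local Notation term := (hecke_term S).

Inductive hecke_cong : term -> term -> Prop :=
| hc_refl x : hecke_cong x x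
| hc_sym x y : hecke_cong x y -> hecke_cong y x
| hc_trans x y z : hecke_cong x y -> hecke_cong y z -> hecke_cong x z
| hc_add x x' y y' : hecke_cong x x' -> hecke_cong y y' ->
    hecke_cong (HAdd x y) (HAdd x' y')
| hc_mul x x' y y' : hecke_cong x x' -> hecke_cong y y' ->
    hecke_cong (HMul x y) (HMul x' y')
| hc_addA x y z : hecke_cong (HAdd x (HAdd y z)) (HAdd (HAdd x y) z)
| hc_addC x y : hecke_cong (HAdd x y) (HAdd y x)
| hc_add0 x : hecke_cong (HAdd (HConst 0) x) x
| hc_addN x : hecke_cong (HAdd (HMul (HConst (-1)) x) x) (HConst 0)
| hc_mulA x y z : hecke_cong (HMul x (HMul y z)) (HMul (HMul x y) z)
| hc_mul1 x : hecke_cong (HMul (HConst 1) x) x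
| hc_mulDl x y z : hecke_cong (HMul (HAdd x y) z) (HAdd (HMul x z) (HMul y z))
| hc_mulDr x y z : hecke_cong (HMul x (HAdd y z)) (HAdd (HMul x y) (HMul x z))
| hc_constD a b : hecke_cong (HConst (a + b)) (HAdd (HConst a) (HConst b))
| hc_constM a b : hecke_cong (HConst (a * b)) (HMul (HConst a) (HConst b))
| hc_constC a x : hecke_cong (HMul (HConst a) x) (HMul x (HConst a))
| hc_quad (s : S) : hecke_cong (HMul (HGen s) (HGen s))
    (HAdd (HConst 1) (HMul (HConst (q - qinv)) (HGen s)))
| hc_braid (s t : S) m : has_order (val s * val t)%g m ->
    hecke_cong (hecke_term_braid m (HGen s) (HGen t))
               (hecke_term_braid m (HGen t) (HGen s)).

Definition hecke_rel : rel term := fun x y => `[< hecke_cong x y >].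

Fact hecke_rel_refl : reflexive hecke_rel.
Proof. by move=> x; apply/asboolP; exact: hc_refl. Qed.
Fact hecke_rel_sym : symmetric hecke_rel.
Proof. by move=> x y; apply/asboolP/asboolP; exact: hc_sym. Qed.
Fact hecke_rel_trans : transitive hecke_rel.
Proof.
by move=> y x z /asboolP xy /asboolP yz; apply/asboolP; exact: hc_trans xy yz.
Qed.

Canonical hecke_equiv :=
  EquivRel hecke_rel hecke_rel_refl hecke_rel_sym hecke_rel_trans.

Definition hecke : Type := {eq_quot hecke_equiv}.
HB.instance Definition _ : EqQuotient _ hecke_equiv hecke := EqQuotient.on hecke.
HB.instance Definition _ := Choice.on hecke.

Definition hecke_class (x : term) : hecke := \pi_hecke x.

Lemma hecke_classP x y : hecke_class x = hecke_class y <-> hecke_cong x y.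
Proof.
split=> [/eqmodP/asboolP //|xy].
by apply/eqmodP/asboolP.
Qed.

Lemma hecke_classK (x : hecke) : hecke_class (repr x) = x.
Proof. exact: reprK. Qed.

Lemma repr_hecke_class x : hecke_cong (repr (hecke_class x)) x.
Proof. by apply/hecke_classP; rewrite hecke_classK. Qed.

Lemma heckeW (P : hecke -> Prop) : (forall x, P (hecke_class x)) -> forall x, P x.
Proof. by move=> h x; rewrite -[x]hecke_classK. Qed.

Definition hecke_add (x y : hecke) := hecke_class (HAdd (repr x) (repr y)).
Definition hecke_mul (x y : hecke) := hecke_class (HMul (repr x) (repr y)).
Definition hecke_opp (x : hecke) :=
  hecke_class (HMul (HConst (-1)) (repr x)).

Lemma hecke_addE x y :
  hecke_add (hecke_class x) (hecke_class y) = hecke_class (HAdd x y).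
Proof. by apply/hecke_classP; apply: hc_add; exact: repr_hecke_class. Qed.
Lemma hecke_mulE x y :
  hecke_mul (hecke_class x) (hecke_class y) = hecke_class (HMul x y).
Proof. by apply/hecke_classP; apply: hc_mul; exact: repr_hecke_class. Qed.
Lemma hecke_oppE x :
  hecke_opp (hecke_class x) = hecke_class (HMul (HConst (-1)) x).
Proof.
by apply/hecke_classP; apply: hc_mul; [exact: hc_refl|exact: repr_hecke_class].
Qed.

Fact hecke_addA : associative hecke_add.
Proof.
elim/heckeW=> x; elim/heckeW=> y; elim/heckeW=> z.
by rewrite !hecke_addE; apply/hecke_classP; exact: hc_addA.
Qed.
Fact hecke_addC : commutative hecke_add.
Proof.
elim/heckeW=> x; elim/heckeW=> y.
by rewrite !hecke_addE; apply/hecke_classP; exact: hc_addC.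
Qed.
Fact hecke_add0 : left_id (hecke_class (HConst 0)) hecke_add.
Proof.
by elim/heckeW=> x; rewrite !hecke_addE; apply/hecke_classP; exact: hc_add0.
Qed.
Fact hecke_addN : left_inverse (hecke_class (HConst 0)) hecke_opp hecke_add.
Proof.
elim/heckeW=> x; rewrite hecke_oppE !hecke_addE.
by apply/hecke_classP; exact: hc_addN.
Qed.
HB.instance Definition _ :=
  GRing.isZmodule.Build hecke hecke_addA hecke_addC hecke_add0 hecke_addN.

Fact hecke_mulA : associative hecke_mul.
Proof.
elim/heckeW=> x; elim/heckeW=> y; elim/heckeW=> z.
by rewrite !hecke_mulE; apply/hecke_classP; exact: hc_mulA.
Qed.
Fact hecke_mul1 : left_id (hecke_class (HConst 1)) hecke_mul.
Proof.
by elim/heckeW=> x; rewrite !hecke_mulE; apply/hecke_classP; exact: hc_mul1.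
Qed.
Fact hecke_mulr1 : right_id (hecke_class (HConst 1)) hecke_mul.
Proof.
elim/heckeW=> x; rewrite !hecke_mulE; apply/hecke_classP.
exact: hc_trans (hc_sym (hc_constC _ _)) (hc_mul1 _).
Qed.
Fact hecke_mulDl : left_distributive hecke_mul hecke_add.
Proof.
elim/heckeW=> x; elim/heckeW=> y; elim/heckeW=> z.
by rewrite !(hecke_addE, hecke_mulE); apply/hecke_classP; exact: hc_mulDl.
Qed.
Fact hecke_mulDr : right_distributive hecke_mul hecke_add.
Proof.
elim/heckeW=> x; elim/heckeW=> y; elim/heckeW=> z.
by rewrite !(hecke_addE, hecke_mulE); apply/hecke_classP; exact: hc_mulDr.
Qed.
HB.instance Definition _ := GRing.Zmodule_isPzRing.Build hecke
  hecke_mulA hecke_mul1 hecke_mulr1 hecke_mulDl hecke_mulDr.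

(* The data needed to define a ring morphism out of the Hecke algebra; rep_const
   need not be the structure morphism of an algebra, so that semilinear maps
   such as the bar involution are covered. *)
Record hecke_rep (B : pzRingType) := HeckeRep {
  rep_const : {rmorphism laurent -> B};
  rep_gen : S -> B;
  rep_constC : forall a s, rep_const a * rep_gen s = rep_gen s * rep_const a;
  rep_quad : forall s,
    rep_gen s * rep_gen s = 1 + rep_const (q - qinv) * rep_gen s;
  rep_braid : forall s t m, has_order (val s * val t)%g m ->
    braid m (rep_gen s) (rep_gen t) = braid m (rep_gen t) (rep_gen s) }.

Section Lift.

Context (B : pzRingType) (rho : hecke_rep B).

Fixpoint hecke_eval (x : term) : B :=
  match x with
  | HConst a => rep_const rho a
  | HGen s => rep_gen rho s
  | HAdd x y => hecke_eval x + hecke_eval y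
  | HMul x y => hecke_eval x * hecke_eval y
  end.

Lemma hecke_eval_braid m x y : hecke_eval (hecke_term_braid m x y) =
  braid m (hecke_eval x) (hecke_eval y).
Proof. by elim: m x y => [|m IH] x y /=; rewrite ?rmorph1 ?IH. Qed.

Lemma hecke_eval_constC a x :
  rep_const rho a * hecke_eval x = hecke_eval x * rep_const rho a.
Proof.
elim: x => [b|s|x IHx y IHy|x IHx y IHy] /=.
- by rewrite -!rmorphM mulrC.
- exact: rep_constC.
- by rewrite mulrDr mulrDl IHx IHy.
- by rewrite mulrA IHx -!mulrA IHy.
Qed.

Lemma hecke_eval_cong x y : hecke_cong x y -> hecke_eval x = hecke_eval y.
Proof.
elim=> {x y} //=.
- by move=> x y z _ -> _ ->.
- by move=> x x' y y' _ -> _ ->.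
- by move=> x x' y y' _ -> _ ->.
- by move=> x y z; rewrite addrA.
- by move=> x y; rewrite addrC.
- by move=> x; rewrite rmorph0 add0r.
- by move=> x; rewrite rmorphN1 mulN1r addNr rmorph0.
- by move=> x y z; rewrite mulrA.
- by move=> x; rewrite rmorph1 mul1r.
- by move=> x y z; rewrite mulrDl.
- by move=> x y z; rewrite mulrDr.
- by move=> a b; rewrite rmorphD.
- by move=> a b; rewrite rmorphM.
- exact: hecke_eval_constC.
- by move=> s; rewrite rep_quad rmorph1.
- by move=> s t m st; rewrite !hecke_eval_braid /=; exact: rep_braid.
Qed.

Definition hecke_lift (x : hecke) : B := hecke_eval (repr x).

Lemma hecke_liftE x : hecke_lift (hecke_class x) = hecke_eval x.
Proof. exact/hecke_eval_cong/repr_hecke_class. Qed.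

Fact hecke_lift_nmod : nmod_morphism hecke_lift.
Proof.
split; first by rewrite (hecke_liftE (HConst 0)) /= rmorph0.
elim/heckeW=> x; elim/heckeW=> y.
by rewrite [in LHS]/GRing.add /= hecke_addE !hecke_liftE.
Qed.
Fact hecke_lift_monoid : monoid_morphism hecke_lift.
Proof.
split; first by rewrite (hecke_liftE (HConst 1)) /= rmorph1.
elim/heckeW=> x; elim/heckeW=> y.
by rewrite [in LHS]/GRing.mul /= hecke_mulE !hecke_liftE.
Qed.
HB.instance Definition _ := GRing.isNmodMorphism.Build _ _ hecke_lift
  hecke_lift_nmod.
HB.instance Definition _ := GRing.isMonoidMorphism.Build _ _ hecke_lift
  hecke_lift_monoid.

End Lift.

Fact index_rep_quad (s : S) : q * q = 1 + (q - qinv) * q.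
Proof. by rewrite mulrBl [qinv * _]mulrC mulqV addrCA subrr addr0. Qed.

Definition index_rep : hecke_rep laurent :=
  @HeckeRep laurent idfun (fun=> q) (fun a _ => mulrC a q) index_rep_quad
    (fun _ _ _ _ => erefl).

Fact hecke_oner_neq0 : (1 : hecke) != 0.
Proof.
apply/eqP=> /(congr1 (hecke_lift index_rep)).
by rewrite rmorph1 rmorph0 => /eqP; rewrite oner_eq0.
Qed.
HB.instance Definition _ := GRing.PzSemiRing_isNonZero.Build hecke
  hecke_oner_neq0.

Definition hecke_const (a : laurent) : hecke := hecke_class (HConst a).

Lemma hecke_constD a b : hecke_const (a + b) = hecke_const a + hecke_const b.
Proof.
rewrite [in RHS]/GRing.add /= hecke_addE.
by apply/hecke_classP; exact: hc_constD.
Qed.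
Lemma hecke_constM a b : hecke_const (a * b) = hecke_const a * hecke_const b.
Proof.
rewrite [in RHS]/GRing.mul /= hecke_mulE.
by apply/hecke_classP; exact: hc_constM.
Qed.
Lemma hecke_constC a x : hecke_const a * x = x * hecke_const a.
Proof.
elim/heckeW: x => x; rewrite /GRing.mul /= !hecke_mulE.
by apply/hecke_classP; exact: hc_constC.
Qed.

Definition hecke_scale (a : laurent) (x : hecke) : hecke := hecke_const a * x.

Fact hecke_scaleA a b x :
  hecke_scale a (hecke_scale b x) = hecke_scale (a * b) x.
Proof. by rewrite /hecke_scale hecke_constM mulrA. Qed.
Fact hecke_scale1 : left_id 1 hecke_scale.
Proof. by move=> x; rewrite /hecke_scale mul1r. Qed.
Fact hecke_scaleDr : right_distributive hecke_scale +%R.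
Proof. by move=> a x y; rewrite /hecke_scale mulrDr. Qed.
Fact hecke_scaleDl x : {morph hecke_scale^~ x : a b / a + b}.
Proof. by move=> a b; rewrite /hecke_scale hecke_constD mulrDl. Qed.
HB.instance Definition _ := GRing.Zmodule_isLmodule.Build laurent hecke
  hecke_scaleA hecke_scale1 hecke_scaleDr hecke_scaleDl.

Fact hecke_scaleAl a (x y : hecke) : a *: (x * y) = a *: x * y.
Proof. exact: mulrA. Qed.
HB.instance Definition _ := GRing.Lmodule_isLalgebra.Build laurent hecke
  hecke_scaleAl.
Fact hecke_scaleAr a (x y : hecke) : a *: (x * y) = x * (a *: y).
Proof. by rewrite /GRing.scale /= /hecke_scale mulrA hecke_constC mulrA. Qed.
HB.instance Definition _ := GRing.Lalgebra_isAlgebra.Build laurent hecke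
  hecke_scaleAr.

Lemma hecke_constE a : hecke_const a = a%:A.
Proof. by rewrite /GRing.scale /= /hecke_scale mulr1. Qed.

Definition hecke_gen (s : S) : hecke := hecke_class (HGen s).

Lemma hecke_gen_quad s :
  hecke_gen s * hecke_gen s = 1 + (q - qinv) *: hecke_gen s.
Proof.
rewrite /GRing.mul /GRing.scale /= /hecke_scale /GRing.mul /= !hecke_mulE.
rewrite /GRing.add /= hecke_addE.
by apply/hecke_classP; exact: hc_quad.
Qed.

Lemma hecke_class_braid m x y : hecke_class (hecke_term_braid m x y) =
  braid m (hecke_class x) (hecke_class y).
Proof.
elim: m x y => [|m IH] x y //=.
by rewrite -IH [in RHS]/GRing.mul /= hecke_mulE.
Qed.

Lemma hecke_gen_braid s t m : has_order (val s * val t)%g m ->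
  braid m (hecke_gen s) (hecke_gen t) = braid m (hecke_gen t) (hecke_gen s).
Proof.
move=> st; rewrite -!hecke_class_braid; apply/hecke_classP; exact: hc_braid.
Qed.

Lemma hecke_lift_gen (B : pzRingType) (rho : hecke_rep B) s :
  hecke_lift rho (hecke_gen s) = rep_gen rho s.
Proof. exact: hecke_liftE. Qed.

Lemma hecke_lift_const (B : pzRingType) (rho : hecke_rep B) a :
  hecke_lift rho a%:A = rep_const rho a.
Proof. by rewrite -hecke_constE hecke_liftE. Qed.

Definition hecke_gen_inv (s : S) : hecke := hecke_gen s - (q - qinv)%:A.

Lemma hecke_genV s : hecke_gen s * hecke_gen_inv s = 1.
Proof.
by rewrite /hecke_gen_inv mulrBr hecke_gen_quad -scalerAr mulr1 addrK.
Qed.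
Lemma hecke_Vgen s : hecke_gen_inv s * hecke_gen s = 1.
Proof.
by rewrite /hecke_gen_inv mulrBl hecke_gen_quad -scalerAl mul1r addrK.
Qed.

End Hecke.

Section Braids.

Context (B : pzRingType).
Implicit Types x y : B.

Lemma braidSr m x y : braid m.+1 x y = braid m x y * (if odd m then y else x).
Proof.
elim: m x y => [|m IH] x y; first by rewrite /= mulr1 mul1r.
by rewrite -[braid m.+2 x y]/(x * braid m.+1 y x) IH mulrA /=; case: odd.
Qed.

Lemma braid_inv m x y x' y' : x' * x = 1 -> y' * y = 1 ->
  braid m x' y' * (if odd m then braid m x y else braid m y x) = 1.
Proof.
elim: m x y x' y' => [|m IH] x y x' y' xV yV; first by rewrite /= mulr1.
have -> : (if odd m.+1 then braid m.+1 x y else braid m.+1 y x) =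
          (if odd m then braid m y x else braid m x y) * x.
  by rewrite !braidSr /=; case: odd.
rewrite [braid m.+1 x' y']/=.
rewrite -mulrA [braid m y' x' * _]mulrA.
by rewrite (IH y x y' x') // mul1r.
Qed.

Lemma braid_inv_eq m x y x' y' : x' * x = 1 -> x * x' = 1 ->
    y' * y = 1 -> y * y' = 1 -> braid m x y = braid m y x ->
  braid m x' y' = braid m y' x'.
Proof.
move=> x'x xx' y'y yy' E.
have l : braid m x' y' * braid m x y = 1.
  by rewrite -[RHS](braid_inv m x'x y'y) -E if_same.
have r : braid m x y * braid m y' x' = 1.
  have := braid_inv m yy' xx'; rewrite -E.
  have := braid_inv m xx' yy'.
  by case: odd.
by rewrite -[LHS]mulr1 -r mulrA l mul1r.
Qed.

End Braids.

Section HeckeBar.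

Context {W : groupType} (S : set W).

Definition hecke_bar_const (a : laurent) : hecke S := (laurent_bar a)%:A.

Fact hecke_bar_const_zmod : zmod_morphism hecke_bar_const.
Proof. by move=> a b; rewrite /hecke_bar_const rmorphB scalerBl. Qed.
Fact hecke_bar_const_monoid : monoid_morphism hecke_bar_const.
Proof.
split=> [|a b]; rewrite /hecke_bar_const; first by rewrite rmorph1 scale1r.
by rewrite rmorphM -scalerAl mul1r scalerA.
Qed.
HB.instance Definition _ :=
  GRing.isZmodMorphism.Build _ _ hecke_bar_const hecke_bar_const_zmod.
HB.instance Definition _ :=
  GRing.isMonoidMorphism.Build _ _ hecke_bar_const hecke_bar_const_monoid.

Fact hecke_bar_constC a (s : S) :
  hecke_bar_const a * hecke_gen_inv s = hecke_gen_inv s * hecke_bar_const a.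
Proof. by rewrite -scalerAl mul1r -scalerAr mulr1. Qed.

Fact hecke_bar_quad (s : S) : hecke_gen_inv s * hecke_gen_inv s =
  1 + hecke_bar_const (q - qinv) * hecke_gen_inv s.
Proof.
rewrite /hecke_bar_const rmorphB /= bar_q bar_qinv -opprB scaleNr mulNr.
rewrite -scalerAl mul1r {1}/hecke_gen_inv mulrBl hecke_genV.
by rewrite -scalerAl mul1r.
Qed.

Fact hecke_bar_braid (s t : S) m : has_order (val s * val t)%g m ->
  braid m (hecke_gen_inv s) (hecke_gen_inv t) =
  braid m (hecke_gen_inv t) (hecke_gen_inv s).
Proof.
move=> /hecke_gen_braid.
by apply: braid_inv_eq; [exact: hecke_Vgen|exact: hecke_genV
                        |exact: hecke_Vgen|exact: hecke_genV].
Qed.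

Definition hecke_bar_rep : hecke_rep S (hecke S) :=
  HeckeRep (rep_const := hecke_bar_const)
    hecke_bar_constC hecke_bar_quad hecke_bar_braid.

Definition hecke_bar : hecke S -> hecke S := hecke_lift hecke_bar_rep.
HB.instance Definition _ := GRing.RMorphism.on hecke_bar.

Lemma hecke_bar_gen s : hecke_bar (hecke_gen s) = hecke_gen s - (q - qinv)%:A.
Proof. exact: hecke_lift_gen. Qed.

Lemma hecke_bar_scale a : hecke_bar a%:A = (laurent_bar a)%:A.
Proof. exact: hecke_lift_const. Qed.

End HeckeBar.

Section HeckeIncl.

Context {W : groupType} (K S : set W) (KS : K `<=` S).

Definition incl_gen (s : K) : S := SigSub (mem_set (KS (set_valP s))).

Fact hecke_incl_constC a s : GRing.in_alg (hecke S) a * hecke_gen (incl_gen s) =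
  hecke_gen (incl_gen s) * GRing.in_alg (hecke S) a.
Proof. by rewrite /= -scalerAl mul1r -scalerAr mulr1. Qed.

Fact hecke_incl_quad s : hecke_gen (incl_gen s) * hecke_gen (incl_gen s) =
  1 + GRing.in_alg (hecke S) (q - qinv) * hecke_gen (incl_gen s).
Proof. by rewrite hecke_gen_quad /= -scalerAl mul1r. Qed.

Definition hecke_incl_rep : hecke_rep K (hecke S) :=
  HeckeRep hecke_incl_constC hecke_incl_quad
    (fun s t m => @hecke_gen_braid _ _ (incl_gen s) (incl_gen t) m).

(* The canonical morphism from H_K to H, with T_s sent to T_s for s in K. *)
Definition hecke_incl : hecke K -> hecke S := hecke_lift hecke_incl_rep.
HB.instance Definition _ := GRing.RMorphism.on hecke_incl.

Lemma hecke_incl_gen s : hecke_incl (hecke_gen s) = hecke_gen (incl_gen s).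
Proof. exact: hecke_lift_gen. Qed.

Lemma hecke_incl_scale a : hecke_incl a%:A = a%:A.
Proof. exact: hecke_lift_const. Qed.

End HeckeIncl.

(* The R-module R (x)_R0 M, where R is a right R0-module through phi: formal
   sums of symbols a (x) m, modulo the abelian group axioms, biadditivity and
   (a phi(r)) (x) m = a (x) (r m). *)
Inductive tensor_term (R M : Type) : Type :=
| TPure of R & M
| TZero
| TOpp of tensor_term R M
| TAdd of tensor_term R M & tensor_term R M.
Arguments TZero {R M}.

HB.instance Definition _ (R M : Type) := gen_eqMixin (tensor_term R M).
HB.instance Definition _ (R M : Type) := gen_choiceMixin (tensor_term R M).

Section Tensor.

Context {R0 R : pzRingType} (phi : {rmorphism R0 -> R}) (M : lmodType R0).
Local Notation term := (tensor_term R M).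

Inductive tensor_cong : term -> term -> Prop :=
| tc_refl x : tensor_cong x x
| tc_sym x y : tensor_cong x y -> tensor_cong y x
| tc_trans x y z : tensor_cong x y -> tensor_cong y z -> tensor_cong x z
| tc_opp x x' : tensor_cong x x' -> tensor_cong (TOpp x) (TOpp x')
| tc_add x x' y y' : tensor_cong x x' -> tensor_cong y y' ->
    tensor_cong (TAdd x y) (TAdd x' y')
| tc_addA x y z : tensor_cong (TAdd x (TAdd y z)) (TAdd (TAdd x y) z)
| tc_addC x y : tensor_cong (TAdd x y) (TAdd y x)
| tc_add0 x : tensor_cong (TAdd TZero x) x
| tc_addN x : tensor_cong (TAdd (TOpp x) x) TZero
| tc_pureDl a b m : tensor_cong (TPure (a + b) m) (TAdd (TPure a m) (TPure b m))
| tc_pureDr a m n : tensor_cong (TPure a (m + n)) (TAdd (TPure a m) (TPure a n))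
| tc_pureM a r m : tensor_cong (TPure (a * phi r) m) (TPure a (r *: m)).

Definition tensor_rel : rel term := fun x y => `[< tensor_cong x y >].

Fact tensor_rel_refl : reflexive tensor_rel.
Proof. by move=> x; apply/asboolP; exact: tc_refl. Qed.
Fact tensor_rel_sym : symmetric tensor_rel.
Proof. by move=> x y; apply/asboolP/asboolP; exact: tc_sym. Qed.
Fact tensor_rel_trans : transitive tensor_rel.
Proof.
by move=> y x z /asboolP xy /asboolP yz; apply/asboolP; exact: tc_trans xy yz.
Qed.

Canonical tensor_equiv :=
  EquivRel tensor_rel tensor_rel_refl tensor_rel_sym tensor_rel_trans.

Definition tensor : Type := {eq_quot tensor_equiv}.
HB.instance Definition _ : EqQuotient _ tensor_equiv tensor :=
  EqQuotient.on tensor.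
HB.instance Definition _ := Choice.on tensor.

Definition tensor_class (x : term) : tensor := \pi_tensor x.

Lemma tensor_classP x y : tensor_class x = tensor_class y <-> tensor_cong x y.
Proof.
split=> [/eqmodP/asboolP //|xy].
by apply/eqmodP/asboolP.
Qed.

Lemma tensor_classK (x : tensor) : tensor_class (repr x) = x.
Proof. exact: reprK. Qed.

Lemma repr_tensor_class x : tensor_cong (repr (tensor_class x)) x.
Proof. by apply/tensor_classP; rewrite tensor_classK. Qed.

Lemma tensorW (P : tensor -> Prop) :
  (forall x, P (tensor_class x)) -> forall x, P x.
Proof. by move=> h x; rewrite -[x]tensor_classK. Qed.

Definition tensor_add (x y : tensor) := tensor_class (TAdd (repr x) (repr y)).
Definition tensor_opp (x : tensor) := tensor_class (TOpp (repr x)).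

Lemma tensor_addE x y :
  tensor_add (tensor_class x) (tensor_class y) = tensor_class (TAdd x y).
Proof. by apply/tensor_classP; apply: tc_add; exact: repr_tensor_class. Qed.
Lemma tensor_oppE x : tensor_opp (tensor_class x) = tensor_class (TOpp x).
Proof. by apply/tensor_classP; apply: tc_opp; exact: repr_tensor_class. Qed.

Fact tensor_addA : associative tensor_add.
Proof.
elim/tensorW=> x; elim/tensorW=> y; elim/tensorW=> z.
by rewrite !tensor_addE; apply/tensor_classP; exact: tc_addA.
Qed.
Fact tensor_addC : commutative tensor_add.
Proof.
elim/tensorW=> x; elim/tensorW=> y.
by rewrite !tensor_addE; apply/tensor_classP; exact: tc_addC.
Qed.
Fact tensor_add0 : left_id (tensor_class TZero) tensor_add.
Proof.
by elim/tensorW=> x; rewrite !tensor_addE; apply/tensor_classP; exact: tc_add0.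
Qed.
Fact tensor_addN : left_inverse (tensor_class TZero) tensor_opp tensor_add.
Proof.
elim/tensorW=> x; rewrite tensor_oppE !tensor_addE.
by apply/tensor_classP; exact: tc_addN.
Qed.
HB.instance Definition _ :=
  GRing.isZmodule.Build tensor tensor_addA tensor_addC tensor_add0 tensor_addN.

Fixpoint tensor_term_scale (a : R) (x : term) : term :=
  match x with
  | TPure b m => TPure (a * b) m
  | TZero => TZero
  | TOpp x => TOpp (tensor_term_scale a x)
  | TAdd x y => TAdd (tensor_term_scale a x) (tensor_term_scale a y)
  end.

Lemma tensor_term_scale_cong a x y : tensor_cong x y ->
  tensor_cong (tensor_term_scale a x) (tensor_term_scale a y).
Proof.
elim=> {x y} /=; try by constructor.
- by move=> x y z _ xy _ yz; exact: tc_trans xy yz.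
- by move=> b c m; rewrite mulrDr; exact: tc_pureDl.
- by move=> b r m; rewrite mulrA; exact: tc_pureM.
Qed.

Definition tensor_scale (a : R) (x : tensor) : tensor :=
  tensor_class (tensor_term_scale a (repr x)).

Lemma tensor_scaleE a x :
  tensor_scale a (tensor_class x) = tensor_class (tensor_term_scale a x).
Proof.
by apply/tensor_classP; apply: tensor_term_scale_cong; exact: repr_tensor_class.
Qed.

Fact tensor_scaleA a b x :
  tensor_scale a (tensor_scale b x) = tensor_scale (a * b) x.
Proof.
elim/tensorW: x => x; rewrite !tensor_scaleE; congr tensor_class.
by elim: x => [c m||x IHx|x IHx y IHy] /=; rewrite ?mulrA ?IHx ?IHy.
Qed.
Fact tensor_scale1 : left_id 1 tensor_scale.
Proof.
elim/tensorW=> x; rewrite !tensor_scaleE; congr tensor_class.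
by elim: x => [c m||x IHx|x IHx y IHy] /=; rewrite ?mul1r ?IHx ?IHy.
Qed.
Fact tensor_scaleDr : right_distributive tensor_scale +%R.
Proof.
move=> a; elim/tensorW=> x; elim/tensorW=> y.
by rewrite /GRing.add /= !(tensor_addE, tensor_scaleE).
Qed.
Fact tensor_scaleDl x : {morph tensor_scale^~ x : a b / a + b}.
Proof.
move=> a b; elim/tensorW: x => x; rewrite !tensor_scaleE.
elim: x => [c m||x IHx|x IHx y IHy] /=.
- rewrite mulrDl [RHS]tensor_addE; apply/tensor_classP; exact: tc_pureDl.
- by rewrite [RHS]tensor_addE; apply/tensor_classP; exact/tc_sym/tc_add0.
- by rewrite -!tensor_oppE IHx; exact: opprD.
- by rewrite -!tensor_addE IHx IHy; exact: addrACA.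
Qed.
HB.instance Definition _ := GRing.Zmodule_isLmodule.Build R tensor
  tensor_scaleA tensor_scale1 tensor_scaleDr tensor_scaleDl.

Definition pure_tensor (a : R) (m : M) : tensor := tensor_class (TPure a m).

Lemma pure_tensorDl a b m :
  pure_tensor (a + b) m = pure_tensor a m + pure_tensor b m.
Proof. by rewrite [RHS]tensor_addE; apply/tensor_classP; exact: tc_pureDl. Qed.
Lemma pure_tensorDr a m n :
  pure_tensor a (m + n) = pure_tensor a m + pure_tensor a n.
Proof. by rewrite [RHS]tensor_addE; apply/tensor_classP; exact: tc_pureDr. Qed.
Lemma pure_tensorM a r m : pure_tensor (a * phi r) m = pure_tensor a (r *: m).
Proof. by apply/tensor_classP; exact: tc_pureM. Qed.
Lemma scale_pure_tensor a b m : a *: pure_tensor b m = pure_tensor (a * b) m.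
Proof. exact: tensor_scaleE. Qed.

End Tensor.

Section WGraphIdeal.

Context {W : groupType}.
Implicit Types S J I : set W.

(* The A-module structure of a module over an A-algebra is a, x |-> a%:A *: x. *)
Definition laurent_basis (A : algType laurent) (M : lmodType A) I
    (b : W -> M) : Prop :=
  forall x : M, exists! c : {fsfun W -> laurent with 0},
    (forall w, w \in finsupp c -> I w)
    /\ x = \sum_(w <- finsupp c) (c w)%:A *: b w.

(* Lower Bruhat intervals are finite, so the finitely supported sum below is an
   honest sum over all y in I with y < s w. *)
Definition hecke_action_rules S J I (M : lmodType (hecke S)) (b : W -> M) :=
  forall (s : S) w, I w ->
  [/\ strong_ascent S I w (val s) ->
        hecke_gen s *: b w = b (val s * w)%g,
      strong_descent S w (val s) ->
        hecke_gen s *: b w = b (val s * w)%g + (q - qinv)%:A *: b w,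
      weak_descent S J w (val s) ->
        hecke_gen s *: b w = - (qinv%:A *: b w)
    & weak_ascent S J I w (val s) ->
        exists r : W -> laurent,
          (forall y, qAplus (r y)) /\
          hecke_gen s *: b w = q%:A *: b w -
            \sum_(y \in [set y | I y /\ bruhat_lt S y (val s * w)%g])
              (r y)%:A *: b y].

Definition has_bar_involution S (M : lmodType (hecke S)) (b : W -> M) :=
  exists beta : M -> M,
  [/\ forall x y, beta (x + y) = beta x + beta y,
      forall (a : laurent) x, beta (a%:A *: x) = (laurent_bar a)%:A *: beta x,
      forall x, beta (beta x) = x,
      beta (b 1%g) = b 1%g
    & forall h x, beta (h *: x) = hecke_bar h *: beta x].

(* I is a W_S-graph ideal with respect to J, realized by the module M with the
   basis (b w | w in I); the values of b outside I are irrelevant. *)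
Record wgraph_ideal_module S J I (M : lmodType (hecke S)) (b : W -> M) : Prop :=
  WGraphIdealModule {
    wgi_sub : J `<=` S;
    wgi_ideal : left_ideal S I;
    wgi_one : I 1%g;
    wgi_reps : I `<=` min_coset_reps S J;
    wgi_basis : laurent_basis I b;
    wgi_rules : hecke_action_rules J I b;
    wgi_bar : has_bar_involution b }.

Definition wgraph_ideal S J I : Prop :=
  exists (M : lmodType (hecke S)) (b : W -> M), wgraph_ideal_module J I b.

End WGraphIdeal.

(* Main.v *)
Require Import Defs.
From HB Require Import structures.
From mathcomp Require Import all_boot all_order all_algebra fraction all_fingroup.
From mathcomp Require Import finmap.
From mathcomp Require Import generic_quotient boolp classical_sets fsbigop.
From mathcomp Require Import functions.

Set Implicit Arguments.
Unset Strict Implicit.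
Unset Printing Implicit Defensive.

Import GRing.Theory.
Local Open Scope classical_set_scope.
Local Open Scope ring_scope.

(** Let M be the induced module, the tensor product of H and S_0 over H_K.  The
algebra H is a free right H_K-module on the T_d with d in D_K, so the elements
T_d (x) b_z with d in D_K and z in I_0 form an A-basis of M, indexed by the
products d z.  For s in S, the lemma of Deodhar ([deodhar]) leaves two cases.
Either s d is in D_K, and T_s acts on T_d (x) b_z through the first factor, by
the multiplication rule of the standard basis; then s d z stays in I.  Or
s d = d t with t in K, and T_s (T_d (x) b_z) = T_d (x) T_t b_z, so that s behaves
on d z exactly as t does on z; left translation by d carries descents, the sets
D_J and the Bruhat order of W_K to those of W.  This gives the four rules for I
([induced_rules]).  The bar involution of M is the map that takes h (x) m to the
tensor product of their conjugates; it is balanced because the inclusion of H_K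
in H commutes with the bar involutions ([induced_bar]).

The remaining assertion, that every module realizing I is isomorphic to M, holds
because an ideal determines its module ([wgraph_module_iso]).  Only the
polynomials r in the rule for weak ascents have to be recovered.  If
T_s b_w = q b_w - X, then the involution gives
X - bar X = (T_s - q) (bar b_w - b_w).  As bar b_w - b_w only involves elements
shorter than w, the right-hand side is known by induction on the length, and X,
having its coefficients in q Z[q], is determined by X - bar X: a bar-invariant
combination with such coefficients vanishes, because the bar involution is
unitriangular for the length.

Two facts about H enter.  That T_w does not depend on the reduced word is the
theorem of Matsumoto and Tits ([Tword_reduced]), drawn from the exchange
condition; the latter follows from the presentation of W because the parity of
the number of occurrences of a reflection in the inversion sequence of a word is
unchanged by the relations.  The independence of the T_d (x) b_z is obtained by
letting H act on the functions from W to S_0 by right multiplication.  This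
action commutes with the analogous left operators, which reduces the braid
relations to a computation at 1; and a function supported on one coset d W_K
yields a projection of M onto its component T_d (x) S_0 ([tensor_component]). *)

(** * Words and their reflections *)

Section Words.
Context {W : groupType}.
Implicit Types (S K : set W) (u v w s t r x : W) (a b : seq W).
Local Open Scope group_scope.

Definition wprod a : W := \prod_(s <- a) s.

Lemma wprod_cons s a : wprod (s :: a) = s * wprod a.
Proof. by rewrite /wprod big_cons. Qed.

Lemma wprod_nil : wprod [::] = 1.
Proof. by rewrite /wprod big_nil. Qed.

Lemma wprod_cat a b : wprod (a ++ b) = wprod a * wprod b.
Proof. by rewrite /wprod big_cat. Qed.

Lemma wprod1 s : wprod [:: s] = s.
Proof. by rewrite wprod_cons wprod_nil mulg1. Qed.

Lemma wprod_rcons a s : wprod (rcons a s) = wprod a * s.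
Proof. by rewrite -cats1 wprod_cat wprod1. Qed.

Lemma word_cons S s a : word S (s :: a) <-> S s /\ word S a.
Proof.
split=> [h|[hs ha] x]; first by split=> [|x xa]; apply: h; rewrite inE ?eqxx ?xa ?orbT.
by rewrite inE => /orP[/eqP->|/ha].
Qed.

Lemma word_nil S : word S [::]. Proof. by []. Qed.

Lemma word_cat S a b : word S (a ++ b) <-> word S a /\ word S b.
Proof.
split=> [h|[ha hb] x]; last by rewrite mem_cat => /orP[/ha|/hb].
by split=> x xa; apply: h; rewrite mem_cat xa ?orbT.
Qed.

Lemma word_rev S a : word S (rev a) <-> word S a.
Proof. by split=> h x xa; apply: h; rewrite ?mem_rev // -mem_rev. Qed.

Lemma word_rcons S a s : word S (rcons a s) <-> S s /\ word S a.
Proof.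
rewrite -cats1 word_cat; split=> [[ha /word_cons[hs _]]|[hs ha]]; first by split.
by split=> //; apply/word_cons.
Qed.

Lemma sub_word S K a : K `<=` S -> word K a -> word S a.
Proof. by move=> KS Ka x /Ka/KS. Qed.

(** The inversion sequence of a word s1 ... sn: its i-th term is the reflection
s1 ... si-1 si si-1 ... s1, whose product with s1 ... sn deletes the letter si. *)
Fixpoint refls a : seq W :=
  if a is s :: a' then s :: [seq r ^ s^-1 | r <- refls a'] else [::].

Lemma count_conj x r a : count_mem r [seq y ^ x^-1 | y <- a] = count_mem (r ^ x) a.
Proof.
rewrite count_map; apply: eq_count => y /=.
by rewrite -(inj_eq (@conjg_inj _ x)) conjgKV.
Qed.

Lemma mem_conj x r a : (r \in [seq y ^ x^-1 | y <- a]) = (r ^ x \in a).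
Proof. by rewrite -!has_pred1 !has_count count_conj. Qed.

Lemma count_refls_cat a b r : count_mem r (refls (a ++ b)) =
  (count_mem r (refls a) + count_mem (r ^ wprod a)%g (refls b))%N.
Proof.
elim: a r => [|s a IH] r; first by rewrite wprod_nil conjg1.
by rewrite /= !count_conj IH wprod_cons conjgM addnA.
Qed.

Fixpoint alt n s t : seq W := if n is n'.+1 then s :: alt n' t s else [::].

Lemma size_alt n s t : size (alt n s t) = n.
Proof. by elim: n s t => //= n IH s t; rewrite IH. Qed.

Lemma altSS n s t : alt n.+2 s t = s :: t :: alt n s t.
Proof. by []. Qed.

Lemma alt_double m s t : alt (m + m) s t = flatten (nseq m [:: s; t]).
Proof. by elim: m => // m IH; rewrite addnS addSn altSS IH. Qed.

Lemma alt_cat m n s t :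
  alt (m + n) s t = alt m s t ++ (if odd m then alt n t s else alt n s t).
Proof. by elim: m s t => //= m IH s t; rewrite IH; case: odd. Qed.

Lemma word_alt S n s t : S s -> S t -> word S (alt n s t).
Proof.
move=> hs ht; elim: n s t hs ht => // n IH s t hs ht.
rewrite /=; apply/word_cons; split=> //; exact: IH.
Qed.

Lemma expgM_alt n s t : (s * t) ^+ n * s = s * (t * s) ^+ n.
Proof.
elim: n => [|n IH]; first by rewrite !expg0 mulg1 mul1g.
by rewrite expgS -mulgA IH [in RHS]expgS !mulgA.
Qed.

Section Involutions.
Context {S : set W}.
Context (invS : forall s, S s -> s * s = 1).

Lemma gen_invg s : S s -> s^-1 = s.
Proof. by move=> /invS/mulg1_eq. Qed.

Lemma wprod_rev a : word S a -> wprod (rev a) = (wprod a)^-1.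
Proof.
elim: a => [|s a IH]; first by rewrite /rev /= wprod_nil invg1.
move=> /word_cons[hs /IH {}IH].
by rewrite rev_cons wprod_rcons IH wprod_cons invgM (gen_invg hs).
Qed.

(** The quotient of the two alternating words with n letters is a power of s t. *)
Lemma wprod_alt n s t : S s -> S t ->
  wprod (alt n s t) = (s * t) ^+ n * wprod (alt n t s).
Proof.
elim: n s t => [|n IH] s t hs ht; first by rewrite expg0 mul1g.
rewrite [alt n.+1 s t]/= wprod_cons IH // mulgA -expgM_alt.
rewrite [alt n.+1 t s]/= wprod_cons mulgA expgSr.
by rewrite -!mulgA (mulgA t) invS // mul1g.
Qed.

Lemma refls_alt n s t : S s -> S t ->
  refls (alt n s t) = mkseq (fun i => (s * t) ^+ i * s) n.
Proof.
elim: n s t => // n IH s t hs ht.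
rewrite [LHS]/= IH // /mkseq -[in RHS]add1n iotaD map_cat /= expg0 mul1g.
congr (_ :: _); rewrite add0n (iotaDl 1 0) -!map_comp; apply: eq_map => i /=.
rewrite conjgE invgK gen_invg // !mulgA; congr (_ * _).
by rewrite -expgM_alt add1n expgSr mulgA.
Qed.

(** In the relator (s t)^m the reflections of the second half repeat those of
the first, so each of them occurs an even number of times. *)
Lemma odd_count_relator m s t r : S s -> S t -> (s * t) ^+ m = 1 ->
  odd (count_mem r (refls (flatten (nseq m [:: s; t])))) = false.
Proof.
move=> hs ht st1; rewrite -alt_double refls_alt // /mkseq iotaD add0n map_cat.
rewrite -{2}[m]addn0 iotaDl -map_comp count_cat.
have -> : [seq ((fun i => (s * t) ^+ i * s) \o addn m) i | i <- iota 0 m] =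
          [seq (s * t) ^+ i * s | i <- iota 0 m].
  by apply: eq_map => i /=; rewrite expgnDr st1 mul1g.
by rewrite addnn odd_double.
Qed.

Lemma wprod_flatten m s t : wprod (flatten (nseq m [:: s; t])) = (s * t) ^+ m.
Proof.
elim: m => [|m IH]; first by rewrite wprod_nil.
by rewrite [flatten _]/= !wprod_cons IH expgS mulgA.
Qed.

(** What the relations of the group preserve besides the product: the parity of
the size and of the multiplicity of each reflection. *)
Lemma word_equiv_inv a b : word_equiv S a b ->
  [/\ wprod a = wprod b, odd (size a) = odd (size b)
    & forall r, odd (count_mem r (refls a)) = odd (count_mem r (refls b))].
Proof.
elim=> {a b} [//|a b _ [-> -> h]|a b c _ [-> -> h1] _ [-> -> h2]|a b s t m hs ht [_ st1 _]].
- by split=> // r; rewrite h.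
- by split=> // r; rewrite h1.
rewrite !wprod_cat wprod_flatten st1 mul1g; split=> // [|r].
  rewrite !size_cat !oddD -alt_double size_alt oddD addbb.
  by rewrite addFb.
rewrite !count_refls_cat !oddD odd_count_relator // wprod_flatten st1 conjg1.
by rewrite addFb.
Qed.

End Involutions.
End Words.

(** * Length and inversions *)

Section CoxeterTheory.
Context {W : groupType} {S : set W} (hS : coxeter_system S).
Implicit Types (K J I : set W) (u v w s t r x d z : W) (a b : seq W).
Local Open Scope group_scope.
Local Notation l := (cox_length S).

Lemma gen_sqr s : S s -> s * s = 1.
Proof. by case: hS => h _ _ /h[_ <- _]; rewrite expg2. Qed.
Let invS := gen_sqr.

Lemma genV s : S s -> s^-1 = s.
Proof. exact: (gen_invg invS). Qed.

Lemma gen_subgroupT w : gen_subgroup S w.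
Proof. by case: hS => _ -> _. Qed.

(** The relations apply to words for 1, so a and b are compared through
[a ++ rev b] and [b ++ rev b]. *)
Lemma word_eq_inv a b : word S a -> word S b -> wprod a = wprod b ->
  odd (size a) = odd (size b) /\
  forall r, odd (count_mem r (refls a)) = odd (count_mem r (refls b)).
Proof.
move=> ha hb ab; have eqv c : word S c -> wprod c = 1 ->
    odd (size c) = false /\ forall r, odd (count_mem r (refls c)) = false.
  move=> hc c1; have [_ _ /(_ c hc c1)/(word_equiv_inv invS)[_ -> h]] := hS.
  by split=> // r; rewrite h.
have hrb : word S (rev b) by apply/word_rev.
have p1 : wprod (a ++ rev b) = 1.
  by rewrite wprod_cat (wprod_rev invS) // ab mulgV.
have p2 : wprod (b ++ rev b) = 1 by rewrite wprod_cat (wprod_rev invS) // mulgV.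
have [s1 c1] := eqv _ (iffRL (word_cat S a (rev b)) (conj ha hrb)) p1.
have [s2 c2] := eqv _ (iffRL (word_cat S b (rev b)) (conj hb hrb)) p2.
have xor (b1 b2 b3 : bool) : b1 (+) b2 = false -> b3 (+) b2 = false -> b1 = b3.
  by case: b1; case: b2; case: b3.
split; first by move: s1 s2; rewrite !size_cat !oddD; exact: xor.
by move=> r; move: (c1 r) (c2 r); rewrite !count_refls_cat !oddD ab; exact: xor.
Qed.

Lemma gen_lengthP K w : gen_subgroup K w -> exists a,
  [/\ word K a, size a = cox_length K w & w = wprod a].
Proof.
move=> [a0 ha0 wa0]; rewrite /cox_length; case: pselect => [ex|[]]; last first.
  by exists (size a0); apply/asboolP; exists a0.
by case: ex_minnP => n /asboolP[a [ha sa wa]] _; exists a.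
Qed.

Lemma gen_length_le K w a : word K a -> w = wprod a -> (cox_length K w <= size a)%N.
Proof.
move=> ha wa; rewrite /cox_length; case: pselect => [ex|//].
by case: ex_minnP => n _; apply; apply/asboolP; exists a.
Qed.

Lemma lengthP w : exists a, [/\ word S a, size a = l w & w = wprod a].
Proof. exact/gen_lengthP/gen_subgroupT. Qed.

Lemma length_le a : word S a -> (l (wprod a) <= size a)%N.
Proof. by move=> ha; exact: gen_length_le ha _. Qed.

Lemma length1 : l 1 = 0%N.
Proof. by apply/eqP; rewrite -leqn0 -wprod_nil; exact: (length_le (@word_nil W S)). Qed.

Lemma length0_eq1 w : l w = 0%N -> w = 1.
Proof. by have [a [_ <- ->]] := lengthP w; move=> /size0nil->; rewrite wprod_nil. Qed.

Lemma lengthM u v : (l (u * v)%g <= l u + l v)%N.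
Proof.
have [a [ha <- ->]] := lengthP u; have [b [hb <- ->]] := lengthP v.
by rewrite -wprod_cat -size_cat length_le //; apply/word_cat.
Qed.

Lemma lengthV w : l w^-1 = l w.
Proof.
suff le x : (l x^-1%g <= l x)%N by apply/eqP; rewrite eqn_leq le -{1}[w]invgK le.
have [a [ha <- ->]] := lengthP x.
by rewrite -(wprod_rev invS) // -size_rev length_le //; apply/word_rev.
Qed.

Lemma odd_length a : word S a -> odd (l (wprod a)) = odd (size a).
Proof. by move=> ha; have [b [hb <- e]] := lengthP (wprod a); case: (word_eq_inv hb ha). Qed.

Lemma odd_lengthM u v : odd (l (u * v)) = odd (l u) (+) odd (l v).
Proof.
have [a [ha sa ->]] := lengthP u; have [b [hb sb ->]] := lengthP v.
by rewrite -wprod_cat !odd_length ?size_cat ?oddD //; apply/word_cat.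
Qed.

Lemma odd_length_gen s : S s -> odd (l s).
Proof. by move=> hs; rewrite -[s]wprod1 odd_length //; apply/word_cons. Qed.

Lemma odd_length_refl s x : S s -> odd (l (s ^ x)).
Proof.
move=> hs; rewrite conjgE !odd_lengthM lengthV (odd_length_gen hs).
by case: (odd (l x)).
Qed.

(** For a reflection r this means l (r w) < l w.  The parity of occurrences in
an arbitrary word makes the notion additive ([inversionM]), from which the
exchange condition and its variants are read off. *)
Definition inversion w r : bool :=
  `[< exists a, [/\ word S a, w = wprod a & odd (count_mem r (refls a))] >].

Lemma inversionE a r : word S a -> inversion (wprod a) r = odd (count_mem r (refls a)).
Proof.
move=> ha; apply/asboolP/idP => [[b [hb ab]]|]; last by exists a.
by case: (word_eq_inv ha hb ab) => _ ->.
Qed.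

Lemma inversionM u v r : inversion (u * v) r = inversion u r (+) inversion v (r ^ u).
Proof.
have [a [ha _ ->]] := lengthP u; have [b [hb _ ->]] := lengthP v.
rewrite -wprod_cat !inversionE ?count_refls_cat ?oddD //.
by apply/word_cat.
Qed.

Lemma inversion_gen s r : S s -> inversion s r = (s == r).
Proof.
move=> hs; rewrite -{1}[s]wprod1 inversionE; last exact/word_cons.
by rewrite /= addn0 oddb.
Qed.

(** The exchange condition: the prefix of [a] that carries [r] loses its last
letter. *)
Lemma exchange a r : word S a -> r \in refls a ->
  exists b, [/\ {subset b <= a}, (size b < size a)%N & r * wprod a = wprod b].
Proof.
elim: a r => // s a IH r /word_cons[hs ha]; rewrite [refls _]/= inE => /orP[/eqP->|].
  exists a; split=> //; first by move=> x xa; rewrite inE xa orbT.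
  by rewrite wprod_cons mulgA invS // mul1g.
rewrite mem_conj => /(IH _ ha)[b [ba sb rb]]; exists (s :: b); split=> //.
  by move=> x; rewrite !inE => /orP[->//|/ba->]; rewrite orbT.
by rewrite !wprod_cons -rb conjgE !mulgA mulgV mul1g.
Qed.

Lemma inversion_lt w r : inversion w r -> (l (r * w)%g < l w)%N.
Proof.
have [a [ha sa wa]] := lengthP w; rewrite {1}wa inversionE // => /odd_gt0.
rewrite -has_count has_pred1 => /(exchange ha)[b [ba sb]].
rewrite -wa -sa => ->; have hb : word S b by move=> x /ba/ha.
exact: leq_ltn_trans (length_le hb) sb.
Qed.

(** If s is not an inversion of w then it is one of s w, by additivity. *)
Lemma inversionP w s : S s -> inversion w s = (l (s * w)%g < l w)%N.
Proof.
move=> hs; apply/idP/idP => [|lt]; first exact: inversion_lt.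
apply: contraLR lt => ninv; rewrite -leqNgt.
have : inversion (s * w) s.
  by rewrite inversionM inversion_gen // eqxx conjgE mulKg (negbTE ninv).
by move=> /inversion_lt; rewrite mulgA invS // mul1g => /ltnW.
Qed.

Lemma length_ascent w s : S s -> ~~ inversion w s -> l (s * w) = (l w).+1.
Proof.
move=> hs; rewrite inversionP // -leqNgt => le; apply/eqP; rewrite eqn_leq.
have ls : (l s <= 1)%N by rewrite -[s]wprod1 (@length_le [:: s]) //; apply/word_cons.
have -> : (l (s * w)%g <= (l w).+1)%N.
  by rewrite -add1n (leq_trans (lengthM _ _)) // leq_add2r.
rewrite ltn_neqAle le andbT; apply/eqP => e.
have := odd_lengthM s w; rewrite -e (odd_length_gen hs).
by case: (odd (l w)).
Qed.

Lemma length_descent w s : S s -> inversion w s -> l w = (l (s * w)).+1.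
Proof.
move=> hs inv; rewrite -[in LHS](mulKg s w) genV //.
apply: length_ascent => //.
by rewrite inversionM inversion_gen // eqxx conjgE mulKg inv.
Qed.

Lemma length_gen s : S s -> l s = 1%N.
Proof.
by move=> hs; rewrite -[s]mulg1 (length_ascent hs) ?inversionP // length1.
Qed.

Definition rdescent w t := inversion w^-1 t.

Lemma rdescentP w t : S t -> rdescent w t = (l (w * t)%g < l w)%N.
Proof.
move=> ht; rewrite /rdescent inversionP // lengthV.
by rewrite -[X in (X < _)%N]lengthV invgM invgK genV.
Qed.

Lemma length_rascent w t : S t -> ~~ rdescent w t -> l (w * t) = (l w).+1.
Proof.
move=> ht nd; rewrite -lengthV invgM genV // length_ascent // lengthV //.
Qed.

Lemma rascentP w t : S t -> ~~ rdescent w t = (l w < l (w * t)%g)%N.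
Proof.
move=> ht; apply/idP/idP => [/(length_rascent ht)->//|].
by rewrite rdescentP // -leqNgt => /ltnW.
Qed.

Lemma ascentP w s : S s -> ~~ inversion w s = (l w < l (s * w)%g)%N.
Proof.
move=> hs; apply/idP/idP => [/(length_ascent hs)->//|].
by rewrite inversionP // -leqNgt => /ltnW.
Qed.

Lemma rdescent_mulg w t : S t -> rdescent (w * t) t = ~~ rdescent w t.
Proof.
by move=> ht; rewrite /rdescent invgM (genV ht) inversionM inversion_gen // eqxx conjgE mulKg.
Qed.

(** Right multiplication by t changes the left descents of w only if it
coincides with a left multiplication, because a generator has no other inversion
than itself. *)
Lemma inversion_mulr w s t : S s -> S t ->
  inversion (w * t) s = inversion w s (+) (s * w == w * t).
Proof.
move=> hs ht; rewrite inversionM (inversion_gen _ ht); congr addb.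
by rewrite conjgE -(can_eq (mulKg w)) mulVKg eq_sym.
Qed.

Lemma rdescent_mull w s t : S s -> S t ->
  rdescent (s * w) t = rdescent w t (+) (s * w == w * t).
Proof.
move=> hs ht; rewrite /rdescent invgM (genV hs) inversion_mulr //; congr addb.
by rewrite -eqg_inv !invgM invgK !genV // eq_sym.
Qed.

(** * Parabolic subgroups *)

(** Reduction only deletes letters, so it stays inside a parabolic subgroup;
hence the length of W_K is the restriction of that of W. *)
Lemma word_reduce a : word S a -> exists b,
  [/\ {subset b <= a}, wprod b = wprod a & size b = l (wprod a)].
Proof.
move=> ha; have [n] := ubnP (size a).
elim: n a ha => // n IHn a ha /ltnSE le.
suff : size a = l (wprod a) \/ exists b, [/\ {subset b <= a}, wprod b = wprod a & (size b < size a)%N].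
  case=> [e|[b [ba eb sb]]]; first by exists a; split.
  have [] // := IHn b _ (leq_trans sb le); first by move=> x /ba/ha.
  by move=> c [cb ec sc]; exists c; rewrite -eb; split=> // x /cb/ba.
(* Reduce a proper tail first; a reduced tail fails to extend exactly when s is
an inversion, and then the exchange condition cancels s against a letter. *)
elim: a ha {le} => [|s a IH] /=; first by rewrite wprod_nil length1; left.
move=> /word_cons[hs ha]; have [e|[b [ba eb sb]]] := IH ha; last first.
  right; exists (s :: b); split=> //; last by rewrite !wprod_cons eb.
  by move=> x; rewrite !inE => /orP[->//|/ba->]; rewrite orbT.
have [inv|ninv] := boolP (inversion (wprod a) s); last first.
  by left; rewrite wprod_cons length_ascent // -e.
have : s \in refls a.
  by rewrite -has_pred1 has_count odd_gt0 // -inversionE.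
move=> /(exchange ha)[b [ba sb eb]]; right; exists b.
split; first by move=> x /ba; rewrite inE orbC => ->.
  by rewrite wprod_cons eb.
exact: leqW sb.
Qed.

Section Parabolic.
Context {K : set W} (KS : K `<=` S).

Lemma gen_reduced z : gen_subgroup K z ->
  exists a, [/\ word K a, size a = l z & z = wprod a].
Proof.
move=> [a ha ->]; have [b [ba eb sb]] := word_reduce (sub_word KS ha).
by exists b; split=> // x /ba/ha.
Qed.

Lemma gen_length z : gen_subgroup K z -> cox_length K z = l z.
Proof.
move=> hz; apply/eqP; rewrite eqn_leq; apply/andP; split.
  by have [a [ha <- e]] := gen_reduced hz; exact: gen_length_le ha e.
have [a [ha <- {1}->]] := gen_lengthP hz; apply: length_le; exact: sub_word ha.
Qed.

Lemma gen_sub1 : gen_subgroup K 1.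
Proof. by exists [::] => //; rewrite -[LHS]wprod_nil. Qed.

Lemma gen_subM u v : gen_subgroup K u -> gen_subgroup K v -> gen_subgroup K (u * v).
Proof.
move=> [a ha ->] [b hb ->]; exists (a ++ b); first exact/word_cat.
by rewrite -[RHS]/(wprod _) wprod_cat.
Qed.

Lemma gen_sub_gen s : K s -> gen_subgroup K s.
Proof. by move=> hs; exists [:: s]; [apply/word_cons; split|rewrite -[LHS]wprod1]. Qed.

Lemma gen_subV u : gen_subgroup K u -> gen_subgroup K u^-1.
Proof.
move=> [a ha ->]; exists (rev a); first exact/word_rev.
by rewrite -/(wprod a) -(wprod_rev invS) //; exact: sub_word ha.
Qed.

Lemma gen_sub_mulgr u v : gen_subgroup K u -> gen_subgroup K (v * u) -> gen_subgroup K v.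
Proof. by move=> hu hv; rewrite -(mulgK u v); apply: gen_subM => //; exact: gen_subV. Qed.

Lemma gen_sub_mulgl u v : gen_subgroup K u -> gen_subgroup K (u * v) -> gen_subgroup K v.
Proof. by move=> hu hv; rewrite -(mulKg u v); apply: gen_subM => //; exact: gen_subV. Qed.

(** Building an element of W_K from the left along a reduced K-word. *)
Lemma gen_ind_r (P : W -> Prop) : P 1 ->
  (forall z t, gen_subgroup K z -> K t -> ~~ rdescent z t -> P z -> P (z * t)) ->
  forall z, gen_subgroup K z -> P z.
Proof.
move=> P1 PS z /gen_reduced[a [ha sa ez]]; rewrite {}ez in sa *.
elim/last_ind: a ha sa => [|a t IH]; first by rewrite wprod_nil.
move=> /word_rcons[ht ha]; rewrite size_rcons wprod_rcons => sa.
have [hSt hSa] := (KS ht, sub_word KS ha).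
have lt : (l (wprod a) < l (wprod a * t)%g)%N by rewrite -sa ltnS length_le.
have nd : ~~ rdescent (wprod a) t by rewrite rascentP.
apply: PS => //; first by exists a.
by apply: IH => //; apply/eqP; move: sa; rewrite length_rascent // => -[->].
Qed.

Lemma suffix_descent z s : gen_subgroup K z -> K s -> inversion z s ->
  suffix_of K (s * z) z.
Proof.
move=> hz hs desc; have hsz := gen_subM (gen_sub_gen hs) hz; split=> //.
have e : z * (s * z)^-1 = s.
  by rewrite invgM mulgA mulgV mul1g genV //; exact: KS.
rewrite e !gen_length //; last exact: gen_sub_gen.
rewrite [in RHS](length_descent (KS hs) desc).
by rewrite (length_gen (KS hs)).
Qed.

Lemma gen_sub_le L : L `<=` K -> gen_subgroup L `<=` gen_subgroup K.
Proof. by move=> LK z [a ha ->]; exists a => // x /ha/LK. Qed.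

End Parabolic.

(** * Dihedral subgroups *)

Lemma has_orderC s t m : S s -> S t -> has_order (s * t) m -> has_order (t * s) m.
Proof.
have E k : S s -> S t -> (t * s) ^+ k = (s * t) ^- k.
  by move=> hs ht; rewrite -expVgn invgM (genV hs) (genV ht).
move=> hs ht [m0 m1 mk]; split=> // [|k km]; rewrite E //; first by rewrite m1 invg1.
by move=> /eqP; rewrite invg_eq1 => /eqP; exact: mk.
Qed.

(** A descent at the first letter would make s one of the reflections (t s)^i t
with i < m - 1, so that (t s)^(i + 1) = 1. *)
Lemma length_alt m s t n : S s -> S t -> has_order (s * t) m -> (n <= m)%N ->
  l (wprod (alt n s t)) = n.
Proof.
elim: n s t => [|n IH] s t hs ht st le; first by rewrite wprod_nil length1.
have ts := has_orderC hs ht st.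
rewrite [alt _ _ _]/= wprod_cons length_ascent // ?IH ?(ltnW le) //.
rewrite inversionE; last exact: word_alt.
rewrite (refls_alt invS) //; apply/negP => /odd_gt0; rewrite -has_count has_pred1.
move=> /mapP[i]; rewrite mem_iota add0n /= => ltin e.
case: ts => _ _ /(_ i.+1); case; first by rewrite (leq_trans _ le) // ltnS.
by rewrite expgSr mulgA -e invS.
Qed.

Lemma wprod_altC m s t : S s -> S t -> has_order (s * t) m ->
  wprod (alt m s t) = wprod (alt m t s).
Proof. by move=> hs ht [_ st1 _]; rewrite (wprod_alt invS) // st1 mul1g. Qed.

Lemma reduced_catl a b : word S a -> word S b ->
  l (wprod (a ++ b)) = size (a ++ b) -> l (wprod a) = size a.
Proof.
move=> ha hb e; apply/eqP; rewrite eqn_leq length_le //=.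
rewrite -(leq_add2r (size b)) -size_cat -e wprod_cat.
by rewrite (leq_trans (lengthM _ _)) // leq_add2l length_le.
Qed.

Lemma reduced_catr a b : word S a -> word S b ->
  l (wprod (a ++ b)) = size (a ++ b) -> l (wprod b) = size b.
Proof.
move=> ha hb e; apply/eqP; rewrite eqn_leq length_le //=.
rewrite -(leq_add2l (size a)) -size_cat -e wprod_cat.
by rewrite (leq_trans (lengthM _ _)) // leq_add2r length_le.
Qed.

(** The equality gives (s t)^k = 1.  If (s t)^m = 1 with 0 < m < k minimal, then
among the reflections of the prefix with m + 1 letters s occurs twice and hence is
not an inversion, although that prefix is reduced and starts with s. *)
Lemma has_order_alt s t k : S s -> S t -> (0 < k)%N ->
  wprod (alt k s t) = wprod (alt k t s) -> l (wprod (alt k s t)) = k ->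
  has_order (s * t) k.
Proof.
move=> hs ht k0 e red; have stk : (s * t) ^+ k = 1.
  by move: e; rewrite (wprod_alt invS) // -[RHS]mul1g => /mulIg.
split=> // j /andP[j0 jk] stj.
have ex : exists j, (0 < j)%N && ((s * t) ^+ j == 1) by exists j; rewrite j0 stj eqxx.
case: (ex_minnP ex) => m /andP[m0 /eqP stm] mmin.
have mk : (m < k)%N by apply: leq_ltn_trans jk; apply: mmin; rewrite j0 stj eqxx.
have {}red : l (wprod (alt m.+1 s t)) = m.+1.
  have := @reduced_catl (alt m.+1 s t)
    (if odd m.+1 then alt (k - m.+1) t s else alt (k - m.+1) s t).
  rewrite -alt_cat subnKC // size_alt red size_alt; apply=> //.
    exact: word_alt.
  by case: ifP => _; apply: word_alt.
have inv : inversion (wprod (alt m.+1 s t)) s.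
  rewrite inversionP // red [alt _ _ _]/= wprod_cons mulgA invS // mul1g ltnS.
  by rewrite -[X in (_ <= X)%N](size_alt m t s) length_le //; apply: word_alt.
move: inv; rewrite inversionE; last exact: word_alt.
rewrite (refls_alt invS) // /mkseq; case: m m0 stm mmin {mk red} => // m _ stm mmin.
rewrite (_ : iota 0 m.+2 = 0%N :: iota 1 m ++ [:: m.+1]); last first.
  by rewrite -(addn1 m.+1) iotaD.
rewrite map_cons map_cat /= count_cat /= expg0 stm !mul1g eqxx.
rewrite (_ : count _ _ = 0%N) //; apply/eqP; rewrite -leqn0 leqNgt -has_count has_pred1.
apply/negP => /mapP[i]; rewrite mem_iota => /andP[i1 im] ei.
have {}ei : (s * t) ^+ i = 1 by apply: (mulIg s); rewrite mul1g.
by have := mmin i; rewrite i1 ei eqxx => /(_ isT); rewrite leqNgt im.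
Qed.

(** Equal adjacent letters would cancel. *)
Lemma reduced_alt s t a : S s -> S t -> (forall x, x \in a -> x = s \/ x = t) ->
  l (wprod (s :: a)) = (size a).+1 -> s :: a = alt (size a).+1 s t.
Proof.
elim: a s t => [//|x a IH] s t hs ht xst red.
have wa : word S (x :: a) by move=> y /xst[->|->].
have ha : word S a by case/word_cons: wa.
have ex : x = t.
  case: (xst x); rewrite ?inE ?eqxx // => exs; move: red.
  rewrite exs !wprod_cons mulgA invS // mul1g => e.
  by have := length_le ha; rewrite e /= ltnNge leqW.
rewrite ex in wa red *; rewrite {1}(IH t s) //.
  by move=> y ya; case: (xst y); rewrite ?inE ?ya ?orbT; [|right|left].
by apply: (@reduced_catr [:: s] (t :: a)) => //; apply/word_cons.
Qed.

(** * Minimal coset representatives *)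

Section Cosets.
Context {K : set W} (KS : K `<=` S).
Local Notation D := (min_coset_reps S K).
Local Notation WK := (gen_subgroup K).

Lemma min_repP d : D d <-> forall s, K s -> ~~ rdescent d s.
Proof.
split=> [[_ h] s hs|h]; first by rewrite rascentP ?h //; exact: KS.
by split=> [|s hs]; [exact: gen_subgroupT|rewrite -rascentP ?h //; exact: KS].
Qed.

Lemma min_rep1 : D 1.
Proof.
by split=> [|s hs]; [exact: gen_subgroupT|rewrite mul1g length1 odd_gt0 // odd_length_gen //; exact: KS].
Qed.

(** Let z t > z.  If t were a right descent of d z, then a reflection r of W_K
would satisfy l (d r) < l d. *)
Lemma shortest_length d z : (forall y, WK y -> (l d <= l (d * y)%g)%N) -> WK z ->
  l (d * z) = (l d + l z)%N.
Proof.
move=> dmin hz; elim/(gen_ind_r KS): z / hz => [|z t hz ht nd IH].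
  by rewrite mulg1 length1 addn0.
have hSt := KS ht; rewrite mulgA (length_rascent hSt nd) (length_rascent hSt) ?IH ?addnS //.
rewrite /rdescent invgM inversionM -/(rdescent z t) (negbTE nd) addFb; apply/negP => /inversion_lt.
set r := _ ^ _; rewrite lengthV -[X in (X < _)%N]lengthV invgM invgK ltnNge dmin //.
apply: (gen_subV KS); rewrite /r conjgE.
have hz' := gen_subV KS hz.
by do !apply: gen_subM => //; [exact: (gen_subV KS)|exact: gen_sub_gen].
Qed.

Lemma exists_shortest w : exists d z,
  [/\ WK z, w = d * z & forall y, WK y -> (l d <= l (d * y)%g)%N].
Proof.
have ex : exists n, `[< exists2 z, WK z & l (w * z) = n >].
  by exists (l (w * 1)); apply/asboolP; exists 1 => //; exact: gen_sub1.
case: (ex_minnP ex) => n /asboolP[z hz <-] nmin; exists (w * z), z^-1.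
split=> [||y hy]; first exact: (gen_subV KS).
  by rewrite mulgK.
by apply: nmin; apply/asboolP; exists (z * y); rewrite ?mulgA //; apply: gen_subM.
Qed.

(** An element of D_K is shortest in its coset: otherwise it is d0 z0 with d0
shortest, lengths add, and the last letter of z0 is a right descent. *)
Lemma min_rep_length d z : D d -> WK z -> l (d * z) = (l d + l z)%N.
Proof.
move=> hd; apply: shortest_length => y hy.
have [d0 [z0 [hz0 e d0min]]] := exists_shortest d.
suff z01 : z0 = 1 by rewrite e z01 mulg1; exact: d0min.
have : z0 = 1 \/ exists z t, [/\ WK z, K t, ~~ rdescent z t & z0 = z * t].
  elim/(gen_ind_r KS): z0 / hz0 {e} => [|z1 t hz1 ht nd _]; first by left.
  by right; exists z1, t.
case=> // -[z1 [t [hz1 ht nd ez]]]; have hSt := KS ht.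
have /negP[] := (min_repP d).1 hd t ht; rewrite rdescentP //.
have -> : d * t = d0 * z1 by rewrite e ez -!mulgA gen_sqr // mulg1.
by rewrite e !shortest_length // ltn_add2l ez length_rascent.
Qed.

Lemma coset_decomp w : exists d z, [/\ D d, WK z & w = d * z].
Proof.
have [d [z [hz e dmin]]] := exists_shortest w; exists d, z; split=> //.
apply/min_repP => s hs; rewrite (rdescentP _ (KS hs)) -leqNgt.
exact/dmin/gen_sub_gen.
Qed.

Lemma coset_decomp_uniq d z d' z' : D d -> D d' -> WK z -> WK z' ->
  d * z = d' * z' -> d = d' /\ z = z'.
Proof.
move=> hd hd' hz hz' e; pose y := z * z'^-1.
have hy : WK y by apply: gen_subM => //; exact: (gen_subV KS).
have ed' : d' = d * y by rewrite mulgA e mulgK.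
have ed : d = d' * y^-1 by rewrite ed' mulgK.
have y1 : y = 1.
  apply: length0_eq1; apply/eqP; rewrite -leqn0 -(leq_add2l (l d)) addn0.
  rewrite -min_rep_length // -ed' [in l d]ed.
  by rewrite min_rep_length ?leq_addr //; exact: (gen_subV KS).
by move: ed' e; rewrite y1 mulg1 => -> /mulgI.
Qed.

Lemma rdescent_min_rep d z t : D d -> WK z -> K t -> rdescent (d * z) t = rdescent z t.
Proof.
move=> hd hz ht; have hSt := KS ht; have hzt := gen_subM hz (gen_sub_gen ht).
by rewrite !rdescentP // -mulgA (min_rep_length hd hzt) (min_rep_length hd hz) ltn_add2l.
Qed.

(** The lemma of Deodhar.  A right descent t in K of s d is not one of d, so by
[rdescent_mull] it satisfies s d = d t. *)
Lemma deodhar d s : D d -> S s -> D (s * d) \/ exists2 t, K t & s * d = d * t.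
Proof.
move=> hd hs; have [|nD] := pselect (D (s * d)); first by left.
right; apply: contrapT => nt; apply: nD; apply/min_repP => t ht.
rewrite rdescent_mull //; last exact: KS.
have /negbTE-> := (min_repP d).1 hd t ht; rewrite addFb.
by apply: contra_notN nt => /eqP e; exists t.
Qed.

End Cosets.

(** The combinatorial content of the theorem of Matsumoto and Tits.  Split off
the component y of w in the dihedral group of s and t.  Both s and t are left
descents of y, so y has two alternating reduced words, which determines the order
of s t. *)
Lemma two_descents K w s t : K `<=` S -> K s -> K t -> gen_subgroup K w -> s <> t ->
    inversion w s -> inversion w t ->
  exists m b, [/\ (0 < m)%N, has_order (s * t) m, word K b,
    w = wprod (alt m s t ++ b) & l w = (m + size b)%N].
Proof.
move=> KS hs ht hw nst is_ it; pose L : set W := [set s; t].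
have LK : L `<=` K by move=> x [->|->].
have LS : L `<=` S by move=> x /LK/KS.
have [Ls Lt] : L s /\ L t by split; [left|right].
have [hSs hSt] := (KS _ hs, KS _ ht).
have [d [z [hd hz e]]] := coset_decomp LS w^-1.
have hy := gen_subV LS hz; set y := z^-1 in hy.
have ew : w = y * d^-1 by rewrite -invgM -e invgK.
have descent x c : L x -> x <> c -> L `<=` [set x; c] -> S c -> inversion w x ->
    y = wprod (alt (l y) x c) /\ (0 < l y)%N.
  move=> Lx nxc Lxc hc iw; have hx := LS _ Lx.
  have iy : inversion y x.
    move: iw; rewrite -[w]invgK -/(rdescent w^-1 x) e (rdescent_min_rep LS) //.
  have ly := length_descent hx iy.
  have [a [ha sa ea]] := gen_reduced LS (gen_subM (gen_sub_gen Lx) hy).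
  have ey : y = wprod (x :: a) by rewrite wprod_cons -ea mulgA gen_sqr // mul1g.
  rewrite ly -sa; split=> //; rewrite ey; congr wprod.
  apply: reduced_alt => //; first by move=> u /ha/Lxc.
  by rewrite -ey ly sa.
have [y1 ly0] : y = wprod (alt (l y) s t) /\ (0 < l y)%N by apply: descent.
have [y2 _] : y = wprod (alt (l y) t s) /\ (0 < l y)%N.
  by apply: descent => // [e'|x [->|->]]; [apply: nst|right|left].
have hd' : gen_subgroup K d^-1.
  by apply: (gen_sub_mulgl KS (gen_sub_le LK hy)); rewrite -ew.
have [b [hb sb eb]] := gen_reduced KS hd'.
exists (l y), b; split=> //; last 2 first.
- by rewrite wprod_cat -y1 -eb.
- by rewrite -lengthV e (min_rep_length LS) // sb /y !lengthV addnC.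
by apply: has_order_alt => //; rewrite -?y1 -?y2.
Qed.

(** * Bruhat order *)

(** Multiplication by a reflection changes the parity of the length, so a step
between distinct elements strictly increases it. *)
Lemma bruhat_le_length u w : bruhat_le S u w ->
  (l u <= l w)%N /\ (l u = l w -> u = w).
Proof.
elim=> {u w} [u w [_ _ le [t tP e]]|u v w _ [uv uv1] _ [vw vw1]].
  split=> //; case: tP => [t1 _|[s [x [hs _ ex]]] elen].
    by rewrite e t1 mul1g.
  have := odd_lengthM t u; rewrite -e -elen ex odd_length_refl //.
  by case: (odd (l u)).
split=> [|e]; first exact: leq_trans vw.
have euv : l u = l v by apply/eqP; rewrite eqn_leq uv e vw.
by rewrite uv1 // vw1 // -euv.
Qed.

Lemma bruhat_lt_length u w : bruhat_lt S u w -> (l u < l w)%N.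
Proof.
move=> [/bruhat_le_length[le e] ne]; rewrite ltn_neqAle le andbT.
by apply/eqP => /e.
Qed.

Section BruhatParabolic.
Context {K : set W} (KS : K `<=` S).
Local Notation WK := (gen_subgroup K).

Lemma bruhat_lt_ascent w s : WK w -> K s -> ~~ inversion w s -> bruhat_lt K w (s * w).
Proof.
move=> hw hs asc; have hSs := KS hs; have hsw := gen_subM (gen_sub_gen hs) hw.
have lt : (l w < l (s * w)%g)%N by rewrite -ascentP.
split; last by move=> e; move: lt; rewrite -e ltnn.
apply: Relation_Operators.t_step; split=> //; first by rewrite !(gen_length KS) // ltnW.
exists s => //; right; exists s, 1; split=> //; first exact: gen_sub1.
by rewrite conjg1.
Qed.

Lemma bruhat_lt_descent w s : WK w -> K s -> inversion w s -> bruhat_lt K (s * w) w.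
Proof.
move=> hw hs inv; have hSs := KS hs; have hsw := gen_subM (gen_sub_gen hs) hw.
have e : s * (s * w) = w by rewrite mulgA gen_sqr // mul1g.
rewrite -[X in bruhat_lt K _ X]e; apply: bruhat_lt_ascent => //.
by rewrite ascentP // e -inversionP.
Qed.

(** Left translation by a minimal representative embeds the Bruhat order of
W_K, as it conjugates reflections and shifts the length by a constant. *)
Lemma bruhat_lt_min_rep d y z : min_coset_reps S K d -> bruhat_lt K y z ->
  bruhat_lt S (d * y) (d * z).
Proof.
move=> hd [le ne]; split; last by move=> /mulgI.
elim: le => {y z ne} [y z [hy hz le [t tP e]]|u v w _ IH1 _ IH2]; last exact: Relation_Operators.t_trans IH2.
apply: Relation_Operators.t_step; split; [exact: gen_subgroupT|exact: gen_subgroupT| |].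
  by rewrite !(min_rep_length KS) // leq_add2l -!(gen_length KS).
exists (t ^ d^-1); last by rewrite e conjgE invgK -!mulgA mulKg.
case: tP => [->|[s [x [hs _ ->]]]]; first by left; rewrite conj1g.
right; exists s, (x * d^-1); split; [exact: KS|exact: gen_subgroupT|].
by rewrite conjgM.
Qed.

End BruhatParabolic.

Lemma bruhat_ascentE w s : S s -> bruhat_lt S w (s * w) <-> ~~ inversion w s.
Proof.
move=> hs; split=> [/bruhat_lt_length|]; first by rewrite ascentP.
by apply: bruhat_lt_ascent => //; exact: gen_subgroupT.
Qed.

Lemma bruhat_descentE w s : S s -> bruhat_lt S (s * w) w <-> inversion w s.
Proof.
move=> hs; split=> [/bruhat_lt_length|]; first by rewrite inversionP.
by apply: bruhat_lt_descent => //; exact: gen_subgroupT.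
Qed.

End CoxeterTheory.

(** * Standard basis of the Hecke algebra *)

Section HeckeInduction.
Context {W : groupType} {S : set W}.

Lemma hecke_mul_ind (P : hecke S -> Prop) :
    (forall x y, P x -> P y -> P (x + y)) -> (forall a x, P x -> P (a *: x)) ->
    (forall s x, P x -> P (hecke_gen s * x)) ->
  forall h x, P x -> P (h * x).
Proof.
move=> PD PZ PM h; elim/(@heckeW W S): h; elim=> [a|s|x IHx y IHy|x IHx y IHy] h Ph.
- by rewrite -[hecke_class _]/(hecke_const S a) hecke_constE -scalerAl mul1r; exact: PZ.
- exact: PM.
- by rewrite -hecke_addE mulrDl; apply: PD; [exact: IHx|exact: IHy].
- by rewrite -hecke_mulE -/(hecke_class x * hecke_class y) -mulrA; apply: IHx; exact: IHy.
Qed.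

Lemma hecke_ind (P : hecke S -> Prop) : P 1 ->
    (forall x y, P x -> P y -> P (x + y)) -> (forall a x, P x -> P (a *: x)) ->
    (forall s x, P x -> P (hecke_gen s * x)) ->
  forall h, P h.
Proof. by move=> P1 PD PZ PM h; rewrite -[h]mulr1; exact: hecke_mul_ind. Qed.

Lemma hecke_rmorph_ext (B : pzRingType) (f g : {rmorphism hecke S -> B}) :
  (forall a, f a%:A = g a%:A) -> (forall s, f (hecke_gen s) = g (hecke_gen s)) ->
  forall h, f h = g h.
Proof.
move=> fgA fgs; apply: hecke_ind => [|x y fx fy|a x fx|s x fx].
- by rewrite !rmorph1.
- by rewrite !rmorphD fx fy.
- have -> : a *: x = a%:A * x by rewrite -scalerAl mul1r.
  by rewrite (rmorphM f) (rmorphM g) fgA fx.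
- by rewrite !rmorphM fgs fx.
Qed.

End HeckeInduction.

Lemma prod_alt (W : groupType) (B : pzRingType) (F : W -> B) m s t :
  \prod_(x <- alt m s t) F x = braid m (F s) (F t).
Proof. by elim: m s t => [|m IH] s t; rewrite /= ?big_nil // big_cons -IH. Qed.

Section StandardBasis.
Context {W : groupType} {S : set W} (hS : coxeter_system S).
Context {K : set W} (KS : K `<=` S).
Implicit Types (s t w z : W) (a b : seq W).
Local Notation l := (cox_length S).
Local Notation WK := (gen_subgroup K).
Local Notation inv := (@inversion W S).
Local Notation rdesc := (@rdescent W S).

(** [hecke_gen] on elements of W; the value outside K is a dummy. *)
Definition Tgen s : hecke K := if insub s is Some s' then hecke_gen (s' : K) else 0.

Lemma Tgen_val (s : K) : Tgen (val s) = hecke_gen s.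
Proof. by rewrite /Tgen valK. Qed.

Lemma TgenE s (hs : K s) : exists s' : K, val s' = s /\ Tgen s = hecke_gen s'.
Proof. by exists (SigSub (mem_set hs)); rewrite -Tgen_val. Qed.

Lemma Tgen_sqr s : K s -> Tgen s * Tgen s = 1 + (q - qinv) *: Tgen s.
Proof. by move=> /TgenE[s' [_ ->]]; exact: hecke_gen_quad. Qed.

Lemma Tgen_braid s t m : K s -> K t -> has_order (s * t)%g m ->
  braid m (Tgen s) (Tgen t) = braid m (Tgen t) (Tgen s).
Proof.
move=> /TgenE[s' [<- ->]] /TgenE[t' [<- ->]]; exact: hecke_gen_braid.
Qed.

Definition Tword a : hecke K := \prod_(s <- a) Tgen s.

Lemma Tword_cons s a : Tword (s :: a) = Tgen s * Tword a.
Proof. by rewrite /Tword big_cons. Qed.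

Lemma Tword_cat a b : Tword (a ++ b) = Tword a * Tword b.
Proof. by rewrite /Tword big_cat. Qed.

Lemma Tword_alt m s t : Tword (alt m s t) = braid m (Tgen s) (Tgen t).
Proof. exact: prod_alt. Qed.

(** The theorem of Matsumoto and Tits.  For first letters s and t that differ, both
words are compared by induction with words for the same element that start with
the longest alternating words in s and t; these are exchanged by the braid
relation. *)
Lemma Tword_reduced a b : word K a -> word K b -> wprod a = wprod b ->
  size a = l (wprod a) -> size b = l (wprod b) -> Tword a = Tword b.
Proof.
have [n] := ubnP (size a).
elim: n a b => // n IH a b /ltnSE le ha hb ab sa sb.
case: a => [|s a] in le ha sa ab *.
  case: b => [//|t b] in hb sb ab *.
  by move: sb; rewrite -ab wprod_nil length1.
case: b => [|t b] in hb sb ab *.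
  by move: sa; rewrite ab wprod_nil length1.
have [/word_cons[hs ha'] /word_cons[ht hb']] := (ha, hb).
have [hSs hSt] := (KS hs, KS ht).
have tail_red u c : word K (u :: c) -> size (u :: c) = l (wprod (u :: c)) ->
    size c = l (wprod c).
  move=> /word_cons[hu hc] e; apply/esym/(@reduced_catr _ _ hS [:: u]).
  - by apply/word_cons; split=> //; exact: KS.
  - exact: sub_word hc.
  - by rewrite -e.
have [ra rb] := (tail_red _ _ ha sa, tail_red _ _ hb sb).
have [est|nst] := pselect (s = t).
  rewrite est !Tword_cons; congr (_ * _); apply: IH => //.
  by apply: (mulgI s); rewrite -wprod_cons ab est wprod_cons.
set w := wprod (s :: a) in sa ab.
have desc u c : K u -> word K c -> size c = l (wprod c) -> w = wprod (u :: c) ->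
    l w = (size c).+1 -> inv w u.
  move=> hu hc ec e el; rewrite (inversionP hS) ?el ?e; last exact: KS.
  by rewrite wprod_cons mulgA (gen_sqr hS) ?mul1g ?ec //; exact: KS.
have iws : inv w s by apply: (desc s a).
have iwt : inv w t by apply: (desc t b); rewrite // ab.
have hw : WK w by exists (s :: a).
have [m [c [m0 ordm hc ew lw]]] := two_descents hS KS hs ht hw nst iws iwt.
have lwa : l w = (size a).+1 by rewrite -sa.
have lwb : l w = (size b).+1 by rewrite ab -sb.
case: m => // m in m0 ordm ew lw *.
have ew' : w = wprod (alt m.+1 t s ++ c).
  by rewrite wprod_cat -(wprod_altC hS hSs hSt ordm) -wprod_cat.
have step u v d : K u -> K v -> word K d -> w = wprod (u :: d) ->
    l w = (size d).+1 -> (size d < n)%N -> size d = l (wprod d) ->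
    w = wprod (alt m.+1 u v ++ c) -> Tword (u :: d) = Tword (alt m.+1 u v ++ c).
  move=> hu hv hd ed ld ln rd e; rewrite [alt _ _ _]/= !Tword_cons.
  have ed' : wprod d = wprod (alt m v u ++ c).
    by apply: (mulgI u); rewrite -!wprod_cons -ed e.
  congr (_ * _); apply: IH => //.
  - by apply/word_cat; split=> //; apply: word_alt.
  - rewrite size_cat size_alt -ed' -rd; apply/eqP.
    by rewrite -eqSS -addSn -lw ld.
rewrite (step s t a) //.
rewrite (step t s b) // -?lwb ?lwa //.
rewrite !Tword_cat !Tword_alt; congr (_ * _); exact: Tgen_braid.
Qed.

(** The standard basis element T_z of H_K.  Lengths are those of W, which agree
with those of W_K. *)
Definition Tstd z : hecke K :=
  Tword (xget [::] [set a | [/\ word K a, size a = l z & z = wprod a]]).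

Lemma TstdE a : word K a -> size a = l (wprod a) -> Tstd (wprod a) = Tword a.
Proof.
move=> ha sa; rewrite /Tstd; case: xgetP => [b _ [hb sb eb]|/(_ a)[]//].
by apply: Tword_reduced; rewrite // -?eb.
Qed.

Lemma Tstd1 : Tstd 1%g = 1.
Proof.
rewrite -(@wprod_nil W) TstdE ?/Tword ?big_nil //.
by rewrite wprod_nil length1.
Qed.

Lemma Tstd_mul u v : WK u -> WK v -> l (u * v)%g = (l u + l v)%N ->
  Tstd (u * v)%g = Tstd u * Tstd v.
Proof.
move=> hu hv; have [a [ha sa ea]] := gen_reduced hS KS hu.
have [b [hb sb eb]] := gen_reduced hS KS hv.
rewrite -sa -sb ea eb -wprod_cat => luv.
rewrite TstdE ?size_cat -?luv //; last exact/word_cat.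
by rewrite !TstdE ?Tword_cat // -?ea -?eb.
Qed.

Lemma Tstd_gen s : K s -> Tstd s = Tgen s.
Proof.
move=> hs; rewrite -{1}(wprod1 s) TstdE; first by rewrite /Tword big_seq1.
  exact/word_cons.
by rewrite wprod1 (length_gen hS (KS hs)).
Qed.

Lemma Tgen_ascent z s : WK z -> K s -> ~~ inv z s -> Tgen s * Tstd z = Tstd (s * z)%g.
Proof.
move=> hz hs asc; rewrite -Tstd_gen // -Tstd_mul //; first exact: gen_sub_gen.
by rewrite (length_ascent hS (KS hs)) // (length_gen hS (KS hs)).
Qed.

Lemma Tgen_descent z s : WK z -> K s -> inv z s ->
  Tgen s * Tstd z = Tstd (s * z)%g + (q - qinv) *: Tstd z.
Proof.
move=> hz hs desc; have hSs := KS hs; have hsz := gen_subM (gen_sub_gen hs) hz.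
have e : (s * (s * z) = z)%g by rewrite mulgA (gen_sqr hS) // mul1g.
have nd : ~~ inv (s * z)%g s.
  by rewrite (ascentP hS) // e -(inversionP hS).
have := Tgen_ascent hsz hs nd; rewrite e => <-.
by rewrite mulrA Tgen_sqr // mulrDl mul1r -scalerAl.
Qed.

Lemma Tstd_rascent z s : WK z -> K s -> ~~ rdesc z s -> Tstd z * Tgen s = Tstd (z * s)%g.
Proof.
move=> hz hs asc; rewrite -Tstd_gen // -Tstd_mul //; first exact: gen_sub_gen.
by rewrite (length_rascent hS (KS hs)) // (length_gen hS (KS hs)) addn1.
Qed.

Lemma Tstd_rdescent z s : WK z -> K s -> rdesc z s ->
  Tstd z * Tgen s = Tstd (z * s)%g + (q - qinv) *: Tstd z.
Proof.
move=> hz hs desc; have hSs := KS hs; have hsz := gen_subM hz (gen_sub_gen hs).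
have e : (z * s * s = z)%g by rewrite -mulgA (gen_sqr hS) // mulg1.
have nd : ~~ rdesc (z * s)%g s.
  by rewrite (rascentP hS) // e -(rdescentP hS).
have := Tstd_rascent hsz hs nd; rewrite e => <-.
by rewrite -mulrA Tgen_sqr // mulrDr mulr1 -scalerAr.
Qed.

End StandardBasis.

Arguments Tstd {W} S {K} z.

Section Inclusion.
Context {W : groupType} {S K : set W} (KS : K `<=` S).
Local Notation incl := (hecke_incl KS).

Lemma incl_Tgen s : K s -> incl (Tgen s) = Tgen s.
Proof.
move=> hs; have [s' [<- ->]] := TgenE hs.
by rewrite hecke_incl_gen -Tgen_val.
Qed.

End Inclusion.

(** * Functions on the group *)

Section EndomorphismRing.
Context (V : zmodType).

Record endo := Endo { endo_fun :> V -> V; endo_additive : zmod_morphism endo_fun }.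

Lemma endoP (f g : endo) : (forall x, f x = g x) -> f = g.
Proof.
case: f g => [f hf] [g hg] /= /funext fg; rewrite {}fg in hf *.
by congr Endo; exact: Prop_irrelevance.
Qed.

HB.instance Definition _ := gen_eqMixin endo.
HB.instance Definition _ := gen_choiceMixin endo.

Lemma endoB (f : endo) x y : f (x - y) = f x - f y.
Proof. exact: endo_additive. Qed.
Lemma endo0 (f : endo) : f 0 = 0.
Proof. by have := endoB f 0 0; rewrite !subrr. Qed.
Lemma endoN (f : endo) x : f (- x) = - f x.
Proof. by rewrite -sub0r endoB endo0 sub0r. Qed.
Lemma endoD (f : endo) x y : f (x + y) = f x + f y.
Proof. by rewrite -{1}[y]opprK endoB endoN opprK. Qed.

Fact endo_zero_subproof : zmod_morphism (fun _ : V => 0 : V).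
Proof. by move=> x y; rewrite subrr. Qed.
Fact endo_add_subproof (f g : endo) : zmod_morphism (fun x => f x + g x).
Proof. by move=> x y; rewrite !endoB opprD addrACA. Qed.
Fact endo_opp_subproof (f : endo) : zmod_morphism (fun x => - f x).
Proof. by move=> x y; rewrite endoB opprB opprK addrC. Qed.
Fact endo_one_subproof : zmod_morphism (fun x : V => x).
Proof. by []. Qed.
Fact endo_mul_subproof (f g : endo) : zmod_morphism (fun x => f (g x)).
Proof. by move=> x y; rewrite !endoB. Qed.

Definition endo_zero := Endo endo_zero_subproof.
Definition endo_add f g := Endo (endo_add_subproof f g).
Definition endo_opp f := Endo (endo_opp_subproof f).
Definition endo_one := Endo endo_one_subproof.
Definition endo_mul f g := Endo (endo_mul_subproof f g).

Fact endo_addA : associative endo_add.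
Proof. by move=> f g h; apply: endoP => x /=; rewrite addrA. Qed.
Fact endo_addC : commutative endo_add.
Proof. by move=> f g; apply: endoP => x /=; rewrite addrC. Qed.
Fact endo_add0 : left_id endo_zero endo_add.
Proof. by move=> f; apply: endoP => x /=; rewrite add0r. Qed.
Fact endo_addN : left_inverse endo_zero endo_opp endo_add.
Proof. by move=> f; apply: endoP => x /=; rewrite addNr. Qed.
HB.instance Definition _ :=
  GRing.isZmodule.Build endo endo_addA endo_addC endo_add0 endo_addN.

Fact endo_mulA : associative endo_mul.
Proof. by move=> f g h; exact: endoP. Qed.
Fact endo_mul1 : left_id endo_one endo_mul.
Proof. by move=> f; exact: endoP. Qed.
Fact endo_mulr1 : right_id endo_one endo_mul.
Proof. by move=> f; exact: endoP. Qed.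
Fact endo_mulDl : left_distributive endo_mul endo_add.
Proof. by move=> f g h; exact: endoP. Qed.
Fact endo_mulDr : right_distributive endo_mul endo_add.
Proof. by move=> f g h; apply: endoP => x /=; rewrite endoD. Qed.
HB.instance Definition _ := GRing.Zmodule_isPzRing.Build endo
  endo_mulA endo_mul1 endo_mulr1 endo_mulDl endo_mulDr.

End EndomorphismRing.

Section RegularAction.
Context {W : groupType} {S : set W} (hS : coxeter_system S).
Context {A : algType laurent} {N : lmodType A}.
Implicit Types (f g : W -> N) (s t w x z : W) (h : hecke S).
Local Notation l := (cox_length S).
Local Notation inv := (@inversion W S).
Local Notation rdesc := (@rdescent W S).
Local Notation cq := ((q - qinv)%:A : A).

(** With f extended linearly from the standard basis to H, [right_op t f] and
[left_op s f] are the functions x |-> f (T_x T_t) and x |-> f (T_s T_x). *)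
Definition right_op t f : W -> N :=
  fun w => f (w * t)%g + (if rdesc w t then cq *: f w else 0).
Definition left_op s f : W -> N :=
  fun w => f (s * w)%g + (if inv w s then cq *: f w else 0).

(** Both sides stand for f (T_s T_w T_t).  The descents of w seen from one side
change under the operator of the other side only if s w = w t, and then the two
descents agree. *)
Lemma left_right_comm s t f : S s -> S t ->
  left_op s (right_op t f) = right_op t (left_op s f).
Proof.
move=> hs ht; apply/funext => w; rewrite /left_op /right_op.
rewrite (rdescent_mull hS) // (inversion_mulr hS) // mulgA.
have [e|_] := eqVneq (s * w)%g (w * t)%g; last first.
  rewrite !addbF; case: (rdesc w t); case: (inv w s); rewrite ?addr0 // ?scalerDr //.
  by rewrite !addrA; congr (_ + _); rewrite addrAC.
have <- : inv w s = rdesc w t by rewrite (inversionP hS) // (rdescentP hS) // e.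
by rewrite !addbT e; case: (inv w s) => /=; rewrite ?addr0.
Qed.

Fact right_op_additive t : zmod_morphism (right_op t).
Proof.
move=> f g; apply/funext => w; rewrite /right_op /=.
rewrite -[RHS]/(f (w * t)%g + (if rdesc w t then cq *: f w else 0) -
                 (g (w * t)%g + (if rdesc w t then cq *: g w else 0))).
rewrite -[(f - g) _]/(f _ - g _) -[(f - g) w]/(f w - g w).
by case: (rdesc w t); rewrite ?addr0 // scalerBr opprD addrACA.
Qed.

Definition right_endo t : endo (W -> N) := Endo (right_op_additive t).

Fact scale_op_additive (a : laurent) :
  zmod_morphism (fun f : W -> N => (fun w => a%:A *: f w) : W -> N).
Proof. by move=> f g; apply/funext => w; exact: scalerBr. Qed.

Definition scale_endo a : endo (W -> N) := Endo (scale_op_additive a).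

Fact scale_endo_zmod : zmod_morphism scale_endo.
Proof.
move=> a b; apply: endoP => f; apply/funext => w /=.
by rewrite scalerBl [LHS]scalerBl.
Qed.
Fact scale_endo_monoid : monoid_morphism scale_endo.
Proof.
split=> [|a b]; apply: endoP => f; apply/funext => w /=; first by rewrite !scale1r.
by rewrite scalerA -scalerAl mul1r scalerA.
Qed.
HB.instance Definition _ :=
  GRing.isZmodMorphism.Build _ _ scale_endo scale_endo_zmod.
HB.instance Definition _ :=
  GRing.isMonoidMorphism.Build _ _ scale_endo scale_endo_monoid.

Fact right_constC a (s : S) : scale_endo a * right_endo (val s) =
  right_endo (val s) * scale_endo a.
Proof.
apply: endoP => f; apply/funext => w /=; rewrite /right_op scalerDr; congr (_ + _).
case: ifP => _; last by rewrite scaler0.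
by rewrite !scalerA -!scalerAl !mul1r !scalerA mulrC.
Qed.

Fact right_quad (s : S) : right_endo (val s) * right_endo (val s) =
  1 + scale_endo (q - qinv) * right_endo (val s).
Proof.
have hs := set_valP s.
apply: endoP => f; apply/funext => w.
rewrite -[RHS]/(f w + cq *: right_op (val s) f w) /= /right_op.
rewrite (rdescent_mulg hS) // -mulgA (gen_sqr hS) // mulg1.
case: (rdesc w (val s)) => /=; first by rewrite addr0 scalerDr.
by rewrite !addr0.
Qed.

(** No correction term appears as long as the lengths add. *)
Lemma right_word a x f : word S a -> l (x * wprod a)%g = (l x + size a)%N ->
  (\prod_(s <- a) right_endo s) f x = f (x * wprod a)%g.
Proof.
elim: a x => [|s a IH] x; first by rewrite big_nil wprod_nil mulg1.
move=> /word_cons[hs ha]; rewrite big_cons wprod_cons mulgA /= => e.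
have lt : (l x < l (x * s)%g)%N.
  rewrite -(leq_add2r (size a)) addSnnS -e (leq_trans (lengthM hS _ _)) //.
  by rewrite leq_add2l length_le.
have nd : ~~ rdesc x s by rewrite (rascentP hS).
rewrite {1}/right_op (negbTE nd) addr0 IH //.
by rewrite e (length_rascent hS) // addSnnS.
Qed.

(** Right operators commute with left ones, so the braid relation needs to be
checked only on values at 1, where both sides evaluate f at the longest element
of a dihedral group. *)
Fact right_braid (s t : S) m : has_order (val s * val t)%g m ->
  braid m (right_endo (val s)) (right_endo (val t)) =
  braid m (right_endo (val t)) (right_endo (val s)).
Proof.
move=> st; have [hs ht] := (set_valP s, set_valP t).
have ts := has_orderC hS hs ht st.
rewrite -!prod_alt; set P := \prod_(x <- _) _; set Q := \prod_(x <- _) _.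
have comm u a f : S u -> word S a -> left_op u ((\prod_(x <- a) right_endo x) f) =
    (\prod_(x <- a) right_endo x) (left_op u f).
  move=> hu; elim: a => [|x a IH]; first by rewrite big_nil.
  move=> /word_cons[hx /IH]; rewrite !big_cons /= => <-.
  exact: left_right_comm.
have PQ1 f : P f 1%g = Q f 1%g.
  rewrite /P /Q !right_word; try exact: word_alt.
  - by rewrite !mul1g (wprod_altC hS hs ht st).
  - by rewrite mul1g length1 size_alt (length_alt hS ht hs ts).
  - by rewrite mul1g length1 size_alt (length_alt hS hs ht st).
(* The value at u v > v of a function is the value at v of its image by
[left_op u], which commutes with P and Q. *)
apply: endoP => f; apply/funext => w; have [a [ha sa ew]] := lengthP hS w.
rewrite {}ew in sa *; elim: a f ha sa => [|u a IH] f; first by rewrite wprod_nil PQ1.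
move=> /word_cons[hu ha]; rewrite wprod_cons /= => sa.
have lt : (l (wprod a) < l (u * wprod a)%g)%N.
  by rewrite -sa ltnS length_le.
have asc : ~~ inv (wprod a) u by rewrite (ascentP hS).
have val g : g (u * wprod a)%g = left_op u g (wprod a).
  by rewrite /left_op (negbTE asc) addr0.
rewrite !val !comm //; try exact: word_alt.
by apply: IH => //; apply/eqP; rewrite -eqSS sa (length_ascent hS).
Qed.

(** H acts on the right of itself, hence on the left of the functions on H. *)
Definition regular_rep : hecke_rep S (endo (W -> N)) :=
  HeckeRep (rep_const := scale_endo) right_constC right_quad right_braid.

Definition ract : hecke S -> endo (W -> N) := hecke_lift regular_rep.
HB.instance Definition _ := GRing.RMorphism.on ract.

Lemma ract_scale a f w : ract a%:A f w = a%:A *: f w.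
Proof. by rewrite /ract hecke_lift_const. Qed.

Lemma ract_Tgen s : S s -> ract (Tgen s) = right_endo s.
Proof. by move=> /TgenE[s' [<- ->]]; rewrite /ract hecke_lift_gen. Qed.

Lemma ract_Tstd w x f : l (x * w)%g = (l x + l w)%N ->
  ract (Tstd S w) f x = f (x * w)%g.
Proof.
have [a [ha sa ew]] := lengthP hS w; rewrite {}ew in sa *; rewrite -sa => e.
rewrite (TstdE hS) // -right_word //; congr (endo_fun _ f x).
elim: a ha {sa e} => [|s a IH] ; first by rewrite /Tword !big_nil rmorph1.
by move=> /word_cons[hs /IH e]; rewrite Tword_cons rmorphM /= e big_cons -ract_Tgen.
Qed.

End RegularAction.

(** * Components of the tensor product *)

Section TensorLift.
Context {R0 R : pzRingType} {phi : {rmorphism R0 -> R}} {M : lmodType R0}.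
Local Notation T := (tensor phi M).
Local Notation pure := (pure_tensor phi).

Lemma pure_tensor0l (m : M) : pure 0 m = 0.
Proof. by apply: (addrI (pure 0 m)); rewrite -pure_tensorDl !addr0. Qed.

Lemma pure_tensorNl a (m : M) : pure (- a) m = - pure a m.
Proof. by apply: (addrI (pure a m)); rewrite -pure_tensorDl !subrr pure_tensor0l. Qed.

Lemma tensor_ind (P : T -> Prop) : (forall a m, P (pure a m)) ->
  (forall x y, P x -> P y -> P (x + y)) -> forall x, P x.
Proof.
move=> Pp PD x; suff [] : P x /\ P (- x) by [].
elim/(@tensorW R0 R phi M): x; elim=> [a m||x [IHx IHNx]|x [IHx IHNx] y [IHy IHNy]].
- by rewrite -/(pure a m) -pure_tensorNl.
- rewrite -[tensor_class _ _]/(0 : T) oppr0; split;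
  by rewrite -(pure_tensor0l 0).
- by rewrite -tensor_oppE -/(- tensor_class phi x) opprK.
- by rewrite -tensor_addE -/(tensor_class phi x + _) opprD; split; exact: PD.
Qed.

Context {V : zmodType} (f : R -> M -> V).
Context (fDl : forall a b m, f (a + b) m = f a m + f b m).
Context (fDr : forall a m n, f a (m + n) = f a m + f a n).
Context (fM : forall a r m, f (a * phi r) m = f a (r *: m)).

Fixpoint tensor_eval (x : tensor_term R M) : V :=
  match x with
  | TPure a m => f a m
  | TZero => 0
  | TOpp x => - tensor_eval x
  | TAdd x y => tensor_eval x + tensor_eval y
  end.

Lemma tensor_eval_cong x y : tensor_cong phi x y -> tensor_eval x = tensor_eval y.
Proof.
elim=> {x y} //=.
- by move=> x y z _ -> _ ->.
- by move=> x y _ ->.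
- by move=> x x' y y' _ -> _ ->.
- by move=> x y z; rewrite addrA.
- by move=> x y; rewrite addrC.
- by move=> x; rewrite add0r.
- by move=> x; rewrite addNr.
Qed.

Definition tensor_lift (x : T) : V := tensor_eval (repr x).

Lemma tensor_lift_pure a m : tensor_lift (pure a m) = f a m.
Proof. by apply: (@tensor_eval_cong _ (TPure a m)); exact: repr_tensor_class. Qed.

Lemma tensor_liftD x y : tensor_lift (x + y) = tensor_lift x + tensor_lift y.
Proof.
apply: (@tensor_eval_cong _ (TAdd (repr x) (repr y))); exact: repr_tensor_class.
Qed.

End TensorLift.

Section Projection.
Context {W : groupType} {S : set W} (hS : coxeter_system S).
Context {K : set W} (KS : K `<=` S) {M : lmodType (hecke K)}.
Local Notation l := (cox_length S).
Local Notation WK := (gen_subgroup K).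
Local Notation D := (min_coset_reps S K).
Local Notation incl := (hecke_incl KS).
Local Notation T := (tensor incl M).
Implicit Types (d w z t : W) (m : M).

(** The component along T_d of T_w (x) m, as a function of w. *)
Definition coset_fun d m : W -> M :=
  fun w => if `[< WK (d^-1 * w)%g >] then Tstd S (d^-1 * w)%g *: m else 0.

Lemma coset_funD d m n : coset_fun d (m + n) = coset_fun d m + coset_fun d n.
Proof.
apply/funext => w; rewrite -[RHS]/(coset_fun d m w + coset_fun d n w) /coset_fun.
by case: asboolP => _; rewrite ?addr0 ?scalerDr.
Qed.

(** The right operator of t in K moves T_t from the argument to m: right descents
in K of d z and z are the same. *)
Lemma coset_fun_gen d m t : D d -> K t ->
  right_endo (S := S) t (coset_fun d m) = coset_fun d (Tgen t *: m).
Proof.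
move=> hd ht; apply/funext => w /=; rewrite /right_op /coset_fun mulgA.
have -> : `[< WK (d^-1 * w * t)%g >] = `[< WK (d^-1 * w)%g >].
  apply/asboolP/asboolP => h; last exact/gen_subM/gen_sub_gen.
  by apply: (gen_sub_mulgr hS KS (gen_sub_gen ht)).
case: asboolP => [hz|_]; last by rewrite scaler0 if_same addr0.
set z := (d^-1 * w)%g in hz *.
have -> : rdescent (S := S) w t = rdescent (S := S) z t.
  by rewrite -[RHS](rdescent_min_rep hS KS hd) // /z mulVKg.
rewrite scalerA; case: ifPn => dz.
  by rewrite (Tstd_rdescent hS KS) // [RHS]scalerDl scalerA mulr_algl.
by rewrite (Tstd_rascent hS KS) // addr0.
Qed.

Lemma coset_funZ d a m w : coset_fun d (a%:A *: m) w = a%:A *: coset_fun d m w.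
Proof.
rewrite /coset_fun; case: asboolP => _; last by rewrite scaler0.
by rewrite !scalerA -scalerAl mul1r -scalerAr mulr1.
Qed.

Lemma coset_fun_incl d k m : D d ->
  ract hS (incl k) (coset_fun d m) = coset_fun d (k *: m).
Proof.
move=> hd; elim/(@hecke_ind W K): k m => [|x y IHx IHy|a x IHx|s x IHx] m.
- by rewrite rmorph1 [ract _ _]rmorph1 scale1r.
- by rewrite rmorphD [ract _ _]rmorphD /= IHx IHy scalerDl coset_funD.
- have -> : a *: x = a%:A * x by rewrite -scalerAl mul1r.
  rewrite (rmorphM incl a%:A x) /= hecke_incl_scale [ract _ _]rmorphM /= IHx.
  by apply/funext => w; rewrite ract_scale -coset_funZ scalerA.
- rewrite rmorphM [ract _ _]rmorphM /= IHx -Tgen_val incl_Tgen ?ract_Tgen.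
  + by rewrite coset_fun_gen ?scalerA //; exact: set_valP.
  + by apply: KS; exact: set_valP.
  + exact: set_valP.
Qed.

Definition coset_pairing d (h : hecke S) m : M := ract hS h (coset_fun d m) 1%g.

Lemma coset_pairingDl d a b m :
  coset_pairing d (a + b) m = coset_pairing d a m + coset_pairing d b m.
Proof. by rewrite /coset_pairing [ract _ _]rmorphD. Qed.

Lemma coset_pairingDr d a m n :
  coset_pairing d a (m + n) = coset_pairing d a m + coset_pairing d a n.
Proof. by rewrite /coset_pairing coset_funD endoD. Qed.

Lemma coset_pairingM d a k m : D d ->
  coset_pairing d (a * incl k) m = coset_pairing d a (k *: m).
Proof. by move=> hd; rewrite /coset_pairing [ract _ _]rmorphM /= coset_fun_incl. Qed.

(** The tensor product is the direct sum of the T_d (x) M over the minimal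
representatives d. *)
Definition tensor_component d : T -> M := tensor_lift (coset_pairing d).

Lemma tensor_componentD d x y : D d ->
  tensor_component d (x + y) = tensor_component d x + tensor_component d y.
Proof.
move=> hd; apply: tensor_liftD; first exact: coset_pairingDl.
  exact: coset_pairingDr.
by move=> *; exact: coset_pairingM.
Qed.

Lemma tensor_component_pure d a m : D d ->
  tensor_component d (pure_tensor incl a m) = coset_pairing d a m.
Proof.
move=> hd; apply: tensor_lift_pure; first exact: coset_pairingDl.
  exact: coset_pairingDr.
by move=> *; exact: coset_pairingM.
Qed.

Lemma tensor_componentZ d a x : D d ->
  tensor_component d (a%:A *: x) = a%:A *: tensor_component d x.
Proof.
move=> hd; elim/(@tensor_ind _ _ incl M): x => [h m|x y IHx IHy].
  rewrite scale_pure_tensor !tensor_component_pure // /coset_pairing.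
  by rewrite [ract _ _]rmorphM /= ract_scale.
by rewrite scalerDr !tensor_componentD // IHx IHy scalerDr.
Qed.

Lemma tensor_component_std d d' m : D d -> D d' ->
  tensor_component d (pure_tensor incl (Tstd S d') m) = if d == d' then m else 0.
Proof.
move=> hd hd'; rewrite tensor_component_pure // /coset_pairing.
rewrite ract_Tstd ?mul1g ?length1 // /coset_fun.
case: eqVneq => [<-|ne].
  by rewrite mulVg; case: asboolP => [_|[]]; rewrite ?(Tstd1 hS KS) ?scale1r //; exact: gen_sub1.
case: asboolP => // hz; case/eqP: ne.
have [] // := coset_decomp_uniq hS KS hd hd' hz gen_sub1.
by rewrite mulVKg mulg1.
Qed.

End Projection.

(** * Linear combinations and bases *)

Section LaurentSpan.
Context {W : groupType} {A : algType laurent} {M : lmodType A}.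
Implicit Types (C : set laurent) (I : set W) (b : W -> M) (w : W) (a : laurent) (x y : M).

(** The set C of coefficients is q Z[q], for the polynomials r of the weak ascents,
or the set of all Laurent polynomials. *)
Inductive lspan C I b : M -> Prop :=
| lspan0 : lspan C I b 0
| lspanS a w x : C a -> I w -> lspan C I b x -> lspan C I b (a%:A *: b w + x).

Lemma scale_laurentC (h : A) a x : h *: (a%:A *: x) = a%:A *: (h *: x).
Proof. by rewrite !scalerA mulr_algl mulr_algr. Qed.

Lemma scale_laurentl (h : A) a x : (a *: h) *: x = a%:A *: (h *: x).
Proof. by rewrite scalerA mulr_algl. Qed.

Lemma lspan_mono C C' I I' b x : C `<=` C' -> I `<=` I' -> lspan C I b x -> lspan C' I' b x.
Proof.
move=> CC II; elim=> [|a w y Ca Iw _ IH]; first exact: lspan0.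
by apply: lspanS; [exact: CC|exact: II|].
Qed.

Lemma lspanD C I b x y : lspan C I b x -> lspan C I b y -> lspan C I b (x + y).
Proof.
elim=> [|a w z Ca Iw _ IH] hy; first by rewrite add0r.
by rewrite -addrA; apply: lspanS => //; exact: IH.
Qed.

Lemma lspan1 C I b a w : C a -> I w -> lspan C I b (a%:A *: b w).
Proof. by move=> Ca Iw; rewrite -[_ *: _]addr0; apply: lspanS => //; exact: lspan0. Qed.

Lemma lspanN C I b x : (forall a, C a -> C (- a)) -> lspan C I b x -> lspan C I b (- x).
Proof.
move=> CN; elim=> [|a w y Ca Iw _ IH]; first by rewrite oppr0; exact: lspan0.
by rewrite opprD -scaleNr -scaleNr; apply: lspanS => //; exact: CN.
Qed.

Lemma lspanZ I b a x : lspan setT I b x -> lspan setT I b (a%:A *: x).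
Proof.
elim=> [|c w y _ Iw _ IH]; first by rewrite scaler0; exact: lspan0.
rewrite scalerDr scalerA -scalerAl mul1r scalerA.
by apply: lspanS.
Qed.

Lemma lspan_gen I b w : I w -> lspan setT I b (b w).
Proof. by move=> Iw; rewrite -[b w]scale1r -[1]scale1r; exact: lspan1. Qed.

Lemma lspan_sum C I b (s : seq W) (c : W -> laurent) :
  (forall w, w \in s -> C (c w) /\ I w) -> lspan C I b (\sum_(w <- s) (c w)%:A *: b w).
Proof.
elim: s => [|w s IH] h; first by rewrite big_nil; exact: lspan0.
rewrite big_cons; have [Cw Iw] := h w (mem_head _ _).
by apply: lspanS => //; apply: IH => y ys; apply: h; rewrite inE ys orbT.
Qed.

(** This covers an infinite set I: if infinitely many terms are nonzero, the sum
is 0 by convention. *)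
Lemma lspan_fsum C I b (c : W -> laurent) : (forall w, C (c w)) ->
  lspan C I b (\sum_(w \in I) (c w)%:A *: b w).
Proof.
move=> hc; apply: lspan_sum => w ws; split=> //; move: ws.
case: finite_supportP => // X XI _ _; exact: XI.
Qed.

Lemma lspan_reindex C I I' b (f : W -> W) x : (forall w, I w -> I' (f w)) ->
  lspan C I (b \o f) x -> lspan C I' b x.
Proof.
move=> fI; elim=> [|a w y Ca Iw _ IH]; first exact: lspan0.
by apply: (lspanS (b := b)) => //; exact: fI.
Qed.

Lemma lspan_seq C I b x : C 0 -> (forall a c, C a -> C c -> C (a + c)) ->
    lspan C I b x ->
  exists (s : seq W) (c : W -> laurent), [/\ uniq s, forall w, w \in s -> I w,
    forall w, C (c w), forall w, w \notin s -> c w = 0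
    & x = \sum_(w <- s) (c w)%:A *: b w].
Proof.
move=> C0 CD; elim=> [|a w y Ca Iw _ [s [c [us sI cC c0 ->]]]].
  by exists [::], (fun=> 0); rewrite big_nil.
have [ws|nws] := boolP (w \in s).
  exists s, (fun u => c u + (if u == w then a else 0)).
  split=> // [u|u us'|]; first by apply: CD => //; case: ifP.
    by rewrite c0 // add0r; case: eqP => // euw; rewrite euw ws in us'.
  rewrite addrC [in RHS](eq_bigr (fun u => (c u)%:A *: b u +
    (if u == w then a else 0)%:A *: b u)); last first.
    by move=> u _; rewrite !scalerDl.
  rewrite big_split /=; congr (_ + _).
  rewrite (bigD1_seq w) //= eqxx big1 ?addr0 // => u /negbTE->.
  by rewrite !scale0r.
exists (w :: s), (fun u => if u == w then a else c u); split.
- by rewrite /= nws.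
- by move=> u; rewrite inE => /orP[/eqP->|/sI].
- by move=> u; case: ifP.
- by move=> u; rewrite inE negb_or => /andP[/negbTE-> /c0].
rewrite big_cons eqxx; congr (_ + _); apply: eq_big_seq => u us'.
by case: eqP => // euw; rewrite -euw us' in nws.
Qed.

Lemma lspan_fsumP C I b x : C 0 -> (forall a c, C a -> C c -> C (a + c)) ->
    lspan C I b x ->
  exists c : W -> laurent, (forall w, C (c w)) /\ x = \sum_(w \in I) (c w)%:A *: b w.
Proof.
move=> C0 CD /(lspan_seq C0 CD)[s [c [us sI cC c0 ->]]]; exists c; split=> //.
rewrite (fsbigE s) //; last by move=> w Iw /c0->; rewrite !scale0r.
rewrite [RHS]big_seq_cond [LHS]big_seq; apply: eq_bigl => w.
by case ws: (w \in s) => //=; rewrite mem_set //; exact: sI.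
Qed.

Lemma big_finsupp (c : {fsfun W -> laurent with 0}) b (s : seq W) : uniq s ->
    (forall w, w \in finsupp c -> w \in s) ->
  \sum_(w <- finsupp c) (c w)%:A *: b w = \sum_(w <- s) (c w)%:A *: b w.
Proof.
move=> us cs; rewrite [RHS](bigID (mem (finsupp c))) /= [X in _ + X]big1 ?addr0; last first.
  by move=> w; rewrite memNfinsupp => /eqP->; rewrite !scale0r.
rewrite -[RHS]big_filter; apply: perm_big; apply: uniq_perm; rewrite ?filter_uniq ?fset_uniq //.
move=> w; rewrite mem_filter; apply/idP/andP => [wc|[]//].
by split=> //; exact: cs.
Qed.

Lemma exists_fsfun (s : seq W) (c : W -> laurent) : (forall w, w \notin s -> c w = 0) ->
  exists d : {fsfun W -> laurent with 0}, d =1 c.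
Proof.
move=> c0; exists [fsfun u in [fset u | u in s]%fset => c u] => u.
by rewrite fsfunE; case: ifPn => //; rewrite !inE /= => /c0->.
Qed.

Section Coordinates.
Context (I : set W) (b : W -> M) (hb : laurent_basis I b).

Definition lcoef x : {fsfun W -> laurent with 0} := sval (cid (hb x)).

Lemma lcoef_out x w : ~ I w -> lcoef x w = 0.
Proof.
rewrite /lcoef; case: (cid _) => c /= [[cI _] _] nI; apply/eqP; rewrite -memNfinsupp.
by apply/negP => /cI.
Qed.

Lemma lcoef_supp x w : w \in finsupp (lcoef x) -> I w.
Proof.
by rewrite mem_finsupp => /eqP; apply: contra_notP; exact: lcoef_out.
Qed.

Lemma lcoef_sum x : x = \sum_(w <- finsupp (lcoef x)) (lcoef x w)%:A *: b w.
Proof. by rewrite /lcoef; case: (cid _) => c /= [[_ <-] _]. Qed.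

Lemma lcoefE x (s : seq W) (c : W -> laurent) : uniq s -> (forall w, w \in s -> I w) ->
    (forall w, w \notin s -> c w = 0) -> x = \sum_(w <- s) (c w)%:A *: b w ->
  forall w, lcoef x w = c w.
Proof.
move=> us sI c0 ex w; have [c' ec] := exists_fsfun c0.
rewrite -ec; suff -> : lcoef x = c' by [].
rewrite /lcoef; case: (cid _) => d /= [_ du]; apply: du; split=> [u|].
  by rewrite mem_finsupp ec => /eqP cu; apply: sI; apply: contra_notT cu; exact: c0.
rewrite (@big_finsupp _ b s) //.
  by rewrite ex; apply: eq_bigr => u _; rewrite ec.
by move=> u; rewrite mem_finsupp ec; apply: contraR => /c0->.
Qed.

Lemma lcoef_gen w u : I w -> lcoef (b w) u = if u == w then 1 else 0.
Proof.
move=> Iw; apply: (@lcoefE _ [:: w] (fun u => if u == w then 1 else 0)) => //.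
- by move=> v; rewrite inE => /eqP->.
- by move=> v; rewrite inE => /negbTE->.
by rewrite big_seq1 eqxx !scale1r.
Qed.

Lemma lcoefD x y w : lcoef (x + y) w = lcoef x w + lcoef y w.
Proof.
pose s := undup (finsupp (lcoef x) ++ finsupp (lcoef y)).
apply: (@lcoefE _ s (fun w => lcoef x w + lcoef y w)); first exact: undup_uniq.
- by move=> u; rewrite mem_undup mem_cat => /orP[] /lcoef_supp.
- move=> u; rewrite mem_undup mem_cat negb_or !memNfinsupp.
  by move=> /andP[/eqP-> /eqP->]; rewrite addr0.
rewrite {1}(lcoef_sum x) {1}(lcoef_sum y) !(@big_finsupp _ b s) ?undup_uniq //.
- by rewrite -big_split; apply: eq_bigr => u _; rewrite !scalerDl.
- by move=> u uy; rewrite mem_undup mem_cat uy orbT.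
- by move=> u ux; rewrite mem_undup mem_cat ux.
Qed.

Lemma lcoefZ a x w : lcoef (a%:A *: x) w = a * lcoef x w.
Proof.
apply: (@lcoefE _ (finsupp (lcoef x)) (fun w => a * lcoef x w)) => //.
- exact: fset_uniq.
- by move=> u /lcoef_supp.
- by move=> u; rewrite memNfinsupp => /eqP->; rewrite mulr0.
rewrite {1}(lcoef_sum x) scaler_sumr; apply: eq_bigr => u _.
by rewrite scalerA mulr_algl scalerA.
Qed.

Lemma lcoef0 w : lcoef 0 w = 0.
Proof. by have := lcoefZ 0 0 w; rewrite scaler0 mul0r. Qed.

Lemma basis_lspan x : lspan setT I b x.
Proof. by rewrite (lcoef_sum x); apply: lspan_sum => w /lcoef_supp. Qed.

Lemma lspan_lcoef C J x : C 0 -> (forall a c, C a -> C c -> C (a + c)) -> J `<=` I ->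
  lspan C J b x -> forall w, C (lcoef x w) /\ (~ J w -> lcoef x w = 0).
Proof.
move=> C0 CD JI; elim=> [|a u y Ca Ju _ IH] w; first by rewrite lcoef0.
have [Cw Jw] := IH w; rewrite lcoefD lcoefZ lcoef_gen; last exact: JI.
case: eqVneq Cw Jw => [->|_] Cw Jw; last by rewrite mulr0 add0r; split.
by rewrite mulr1; split=> [|nJ]; [exact: CD|case: nJ].
Qed.

Lemma lspan_of_lcoef C J x : (forall w, J w -> C (lcoef x w)) ->
  (forall w, ~ J w -> lcoef x w = 0) -> lspan C J b x.
Proof.
move=> hC hJ; rewrite (lcoef_sum x); apply: lspan_sum => w.
rewrite mem_finsupp => /eqP h; suff Jw : J w by split=> //; exact: hC.
by apply: contra_notP h; exact: hJ.
Qed.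

End Coordinates.

Lemma basis_of_forms I b : (forall x, lspan setT I b x) ->
    (forall w, I w -> exists k : M -> laurent,
      [/\ forall x y, k (x + y) = k x + k y, forall a x, k (a%:A *: x) = a * k x
        & forall u, I u -> k (b u) = if u == w then 1 else 0]) ->
  laurent_basis I b.
Proof.
move=> span forms x.
have [||s [c [us sI _ c0 ex]]] := lspan_seq _ _ (span x) => //.
have [d ed] := exists_fsfun c0.
have dI w : w \in finsupp d -> I w.
  by rewrite mem_finsupp ed => /eqP cu; apply: sI; apply: contra_notT cu; exact: c0.
have exd : x = \sum_(w <- finsupp d) (d w)%:A *: b w.
  rewrite (@big_finsupp _ b s) //.
    by rewrite ex; apply: eq_bigr => u _; rewrite ed.
  by move=> u; rewrite mem_finsupp ed; apply: contraR => /c0->.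
exists d; split=> // e [eI exe]; apply/fsfunP => w.
have [Iw|nIw] := pselect (I w); last first.
  by rewrite !fsfun_dflt //; apply: contra_notN nIw; [exact: eI|exact: dI].
have [k [kD kZ kb]] := forms w Iw.
have k0 : k 0 = 0 by have := kZ 0 0; rewrite scaler0 mul0r.
have kx (f : {fsfun W -> laurent with 0}) : (forall u, u \in finsupp f -> I u) ->
    k (\sum_(u <- finsupp f) (f u)%:A *: b u) = f w.
  move=> fI; rewrite (big_morph k kD k0).
  rewrite (eq_big_seq (fun u => if u == w then f w else 0)); last first.
    by move=> u /fI Iu; rewrite kZ kb //; case: eqVneq => [->|]; rewrite ?mulr1 ?mulr0.
  have [wf|nwf] := boolP (w \in finsupp f).
    rewrite (bigD1_seq w) ?fset_uniq //= eqxx big1 ?addr0 // => u /negbTE->//.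
  rewrite big1 ?fsfun_dflt // => u _; by case: ifP.
by rewrite -(kx d) // -exd exe kx.
Qed.

End LaurentSpan.

Section LaurentLinear.
Context {W : groupType} {A A' : algType laurent} {M : lmodType A} {M' : lmodType A'}.

Definition laurent_linear (f : M -> M') :=
  (forall x y, f (x + y) = f x + f y) /\ (forall a x, f (a%:A *: x) = a%:A *: f x).

Lemma laurent_linear0 f : laurent_linear f -> f 0 = 0.
Proof. by move=> [_ fZ]; have := fZ 0 0; rewrite !scaler0 !scale0r. Qed.

Lemma laurent_linearN f x : laurent_linear f -> f (- x) = - f x.
Proof. by move=> [_ fZ]; have := fZ (-1) x; rewrite !scaleN1r. Qed.

Lemma laurent_linearB f x y : laurent_linear f -> f (x - y) = f x - f y.
Proof. by move=> lf; rewrite lf.1 laurent_linearN. Qed.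

Lemma lspan_linear f (C : set laurent) (I : set W) (b : W -> M) (b' : W -> M') x :
  laurent_linear f -> (forall w, I w -> f (b w) = b' w) ->
  lspan C I b x -> lspan C I b' (f x).
Proof.
move=> lf fb; elim=> [|a w y Ca Iw _ IH]; first by rewrite laurent_linear0 //; exact: lspan0.
by rewrite lf.1 lf.2 fb //; exact: lspanS.
Qed.

Lemma basis_map (I : set W) (b : W -> M) (b' : W -> M') : laurent_basis I b ->
  exists f : M -> M', laurent_linear f /\ forall w, I w -> f (b w) = b' w.
Proof.
move=> hb; pose f x := \sum_(w <- finsupp (lcoef hb x)) (lcoef hb x w)%:A *: b' w.
have fE x s : uniq s -> (forall w, w \in finsupp (lcoef hb x) -> w \in s) ->
    f x = \sum_(w <- s) (lcoef hb x w)%:A *: b' w.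
  by move=> us xs; exact: big_finsupp.
exists f; split; first split.
- move=> x y; pose s := undup (finsupp (lcoef hb x) ++ finsupp (lcoef hb y)
                               ++ finsupp (lcoef hb (x + y))).
  have ms u : (u \in s) = [|| u \in finsupp (lcoef hb x), u \in finsupp (lcoef hb y)
                           | u \in finsupp (lcoef hb (x + y))].
    by rewrite mem_undup !mem_cat.
  rewrite !(fE _ s) ?undup_uniq //; try by move=> u uin; rewrite ms uin ?orbT.
  by rewrite -big_split; apply: eq_bigr => u _; rewrite lcoefD !scalerDl.
- move=> a x; rewrite (fE _ (finsupp (lcoef hb x))) //; last first.
    move=> u; rewrite !mem_finsupp lcoefZ.
    by apply: contraNneq => ->; rewrite mulr0.
  rewrite scaler_sumr; apply: eq_bigr => u _.
  by rewrite lcoefZ scalerA mulr_algl scalerA.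
move=> w Iw; rewrite (fE _ [:: w]) ?big_seq1 ?lcoef_gen ?eqxx ?scale1r //.
by move=> u; rewrite mem_finsupp lcoef_gen // inE; case: (u == w); rewrite ?eqxx.
Qed.

End LaurentLinear.

(** * Uniqueness of the module of an ideal *)

Section QAplus.

Lemma qAplus0 : qAplus 0.
Proof. by exists 0; rewrite mulr0 rmorph0. Qed.

Lemma qAplusD a c : qAplus a -> qAplus c -> qAplus (a + c).
Proof. by move=> [p ->] [r ->]; exists (p + r); rewrite mulrDr rmorphD. Qed.

Lemma qAplusN a : qAplus a -> qAplus (- a).
Proof. by move=> [p ->]; exists (- p); rewrite mulrN rmorphN. Qed.

Lemma poly_laurentZX (k : int) i : poly_laurent (k *: 'X^i) = k%:~R * q ^+ i.
Proof.
rewrite -mul_polyC rmorphM rmorphXn /=; congr (_ * _).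
by rewrite -[k in LHS]intz rmorph_int /= rmorph_int.
Qed.

(** For P = X p of size N, multiplying P(1/q) = P(q) by q^N equates a polynomial
of degree at most N with X^N P. *)
Lemma qAplus_bar a : qAplus a -> laurent_bar a = a -> a = 0.
Proof.
move=> [p ->]; set P := 'X * p; rewrite (@barP _ 0 P) ?expr0 ?mulr1 // => e.
pose N := size P.
have eN : poly_laurent ('X^N * P) = poly_laurent (\sum_(i < N) P`_i *: 'X^(N - i)).
  rewrite (rmorphM poly_laurent 'X^N P) -[X in _ * X = _]e (rmorphXn poly_laurent).
  rewrite (rmorph_sum poly_laurent) /= -[poly_laurent 'X]/q.
  have -> : subst_qinv P = \sum_(i < N) (P`_i)%:~R * qinv ^+ i.
    rewrite -{1}(coefK P) poly_def rmorph_sum /=; apply: eq_bigr => i _.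
    rewrite -mul_polyC rmorphM rmorphXn /= subst_qinvX; congr (_ * _).
    by rewrite -[P`_i in LHS]intz rmorph_int /= rmorph_int.
  rewrite mulr_sumr; apply: eq_bigr => i _; rewrite poly_laurentZX mulrCA; congr (_ * _).
  rewrite -{1}(subnK (ltnW (ltn_ord i))) exprD -mulrA -exprMn mulqV expr1n mulr1 //.
suff -> : P = 0 by rewrite rmorph0.
apply/polyP => -[|k]; first by rewrite coef0 /P coefXM.
have /(congr1 (fun r : {poly int} => r`_(N + k.+1))) := poly_laurent_inj eN.
rewrite coefXnM ltnNge leq_addr /= addKn coef0 => ->.
rewrite coef_sum big1 // => i _; rewrite coefZ coefXn.
case: eqP => [h|_]; last by rewrite mulr0.
by have := leq_subr i N; rewrite -h addnS ltnNge leq_addr.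
Qed.

End QAplus.

Section OneModule.
Context {W : groupType} {S : set W} (hS : coxeter_system S) {J I : set W}.
Context {M : lmodType (hecke S)} {b : W -> M} (hM : wgraph_ideal_module J I b).
Implicit Types (w u : W) (s : S) (x y : M).
Local Notation l := (cox_length S).
Local Notation inv := (@inversion W S).
Local Notation DJ := (min_coset_reps S J).
Local Notation hb := (wgi_basis hM).
Local Notation qq := ((q - qinv)%:A).

Definition below n : set W := [set w | I w /\ (l w < n)%N].

Lemma ideal_descent w (s : S) : I w -> inv w (val s) -> I (val s * w)%g.
Proof.
move=> Iw iws; have [_ h] := wgi_ideal hM; apply: h Iw _.
apply: (suffix_descent hS) => //; [exact: gen_subgroupT|exact: set_valP].
Qed.

Lemma rule_descent (s : S) w : I w -> inv w (val s) ->
  hecke_gen s *: b w = b (val s * w)%g + qq *: b w.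
Proof.
move=> Iw iws; have [_ h _ _] := wgi_rules hM s Iw; apply: h; split.
  exact: set_valP.
by apply/(bruhat_descentE hS) => //; exact: set_valP.
Qed.

Lemma rule_ascent (s : S) w : I w -> ~~ inv w (val s) -> I (val s * w)%g ->
  hecke_gen s *: b w = b (val s * w)%g.
Proof.
move=> Iw iws Isw; have [h _ _ _] := wgi_rules hM s Iw; apply: h; split=> //.
  exact: set_valP.
by apply/(bruhat_ascentE hS) => //; exact: set_valP.
Qed.

Lemma rule_weak_descent (s : S) w : I w -> ~~ inv w (val s) -> ~ DJ (val s * w)%g ->
  hecke_gen s *: b w = - (qinv%:A *: b w).
Proof.
move=> Iw iws nD; have [_ _ h _] := wgi_rules hM s Iw; apply: h; split=> //.
  exact: set_valP.
by apply/(bruhat_ascentE hS) => //; exact: set_valP.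
Qed.

(** Of the Bruhat order only the consequence for lengths is kept: y < s w implies
l y <= l w. *)
Lemma rule_weak_ascent (s : S) w : I w -> ~~ inv w (val s) ->
    DJ (val s * w)%g -> ~ I (val s * w)%g ->
  exists2 x, lspan qAplus (below (l w).+1) b x & hecke_gen s *: b w = q%:A *: b w - x.
Proof.
move=> Iw iws Dsw nI; have hs := set_valP s; have [_ _ _ h] := wgi_rules hM s Iw.
have [|r [rq ->]] := h; first by split=> //; apply/(bruhat_ascentE hS).
eexists; last by [].
apply: lspan_mono (lspan_fsum _ _ rq) => // y [Iy /(bruhat_lt_length hS) lt].
by split=> //; rewrite -(length_ascent hS hs iws).
Qed.

Lemma below_mono m n : (m <= n)%N -> below m `<=` below n.
Proof. by move=> mn w [Iw lw]; split=> //; exact: leq_trans mn. Qed.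

Lemma lspan_below_mono m n x : (m <= n)%N ->
  lspan setT (below m) b x -> lspan setT (below n) b x.
Proof. by move=> mn; apply: lspan_mono => //; exact: below_mono. Qed.

(** In each of the four rules T_s raises the length by at most one. *)
Lemma gen_lspan_below n (s : S) x : lspan setT (below n) b x ->
  lspan setT (below n.+1) b (hecke_gen s *: x).
Proof.
elim=> [|a w y _ [Iw lw] _ IH]; first by rewrite scaler0; exact: lspan0.
rewrite scalerDr; apply: lspanD => //; have hs := set_valP s.
rewrite scale_laurentC; apply: lspanZ.
have bw : lspan setT (below n.+1) b (b w).
  by apply: lspan_gen; split=> //; exact: leqW.
have [iws|iws] := boolP (inv w (val s)).
  rewrite rule_descent //; apply: lspanD; last exact: lspanZ.
  apply: lspan_gen; split; first exact: ideal_descent.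
  by rewrite (leq_trans _ (leqW lw)) // ltnW // ltnS -(inversionP hS).
have [Isw|nIsw] := pselect (I (val s * w)%g).
  rewrite rule_ascent //; apply: lspan_gen; split=> //.
  by rewrite (length_ascent hS).
have [Dsw|nDsw] := pselect (DJ (val s * w)%g); last first.
  by rewrite rule_weak_descent // -scaleNr -scaleNr; exact: lspanZ.
have [y' hy' ->] := rule_weak_ascent Iw iws Dsw nIsw.
apply: lspanD; first exact: lspanZ.
apply: lspanN => //; apply: lspan_mono hy' => // u [Iu lu]; split=> //.
by rewrite (leq_trans lu) // ltnW.
Qed.

Lemma exists_descent w : w <> 1%g -> exists s : S, inv w (val s).
Proof.
have [a [ha sa ew]] := lengthP hS w; case: a => [|s a] in ha sa ew *.
  by rewrite ew wprod_nil.
move=> _; case/word_cons: (ha) => hs ha'; exists (SigSub (mem_set hs)) => /=.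
rewrite (inversionP hS) // ew wprod_cons mulgA (gen_sqr hS) // mul1g.
by rewrite -wprod_cons -ew -sa ltnS length_le.
Qed.

(** As I is closed under suffixes, each of its elements other than 1 is reached
from a shorter one by a strong ascent. *)
Lemma ideal_ind (P : W -> Prop) : P 1%g ->
    (forall (s : S) v, I v -> I (val s * v)%g -> ~~ inv v (val s) ->
       l (val s * v)%g = (l v).+1 -> P v -> P (val s * v)%g) ->
  forall w, I w -> P w.
Proof.
move=> P1 PS w; have [n] := ubnP (l w); elim: n w => // n IH w /ltnSE le Iw.
have [->//|/exists_descent[s iws]] := pselect (w = 1%g).
have hs := set_valP s; have Iv := ideal_descent Iw iws.
have e : (val s * (val s * w) = w)%g by rewrite mulgA (gen_sqr hS) // mul1g.
have lw := length_descent hS hs iws.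
rewrite -e; apply: PS; rewrite ?e //.
  by rewrite (ascentP hS) // e lw.
by apply: IH => //; rewrite -ltnS -lw ltnS.
Qed.

Section Bar.
Context {beta : M -> M}.
Context (betaD : forall x y, beta (x + y) = beta x + beta y).
Context (betaZ : forall (a : laurent) x, beta (a%:A *: x) = (laurent_bar a)%:A *: beta x).
Context (beta1 : beta (b 1%g) = b 1%g).
Context (betaH : forall h x, beta (h *: x) = hecke_bar h *: beta x).

Lemma beta0 : beta 0 = 0.
Proof. by have := betaZ 0 0; rewrite !scaler0 rmorph0 scale0r scale0r. Qed.

Lemma beta_gen (s : S) x : beta (hecke_gen s *: x) = hecke_gen s *: beta x - qq *: beta x.
Proof. by rewrite betaH hecke_bar_gen scalerBl. Qed.

(** Along a strong ascent from v to s v, the conjugate of b_sv is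
(T_s - (q - 1/q)) applied to that of b_v, whose leading term is T_s b_v = b_sv. *)
Lemma beta_triangular w : I w -> lspan setT (below (l w)) b (beta (b w) - b w).
Proof.
move: w; apply: ideal_ind => [|s v Iv Isv asc lsv IH].
  by rewrite beta1 subrr; exact: lspan0.
rewrite -(rule_ascent Iv asc Isv) beta_gen -{1 2}(subrK (b v) (beta (b v))).
set x := beta (b v) - b v in IH *.
have -> : hecke_gen s *: (x + b v) - qq *: (x + b v) - hecke_gen s *: b v =
    hecke_gen s *: x - qq *: (x + b v).
  by rewrite scalerDr addrAC addrK.
rewrite lsv; apply: lspanD; first exact: gen_lspan_below.
apply: lspanN => //; apply: lspanZ; apply: lspanD.
  exact: lspan_below_mono IH.
by apply: lspan_gen; split.
Qed.

Lemma coef_beta n x w : lspan setT (below n.+1) b x -> I w -> l w = n ->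
  lcoef hb (beta x) w = laurent_bar (lcoef hb x w).
Proof.
move=> + Iw lw; elim=> [|a u y _ [Iu lu] _ IH]; first by rewrite beta0 !lcoef0 rmorph0.
rewrite betaD betaZ !lcoefD !lcoefZ rmorphD rmorphM /= IH; congr (_ * _ + _).
rewrite -[beta (b u)](subrK (b u)) lcoefD lcoef_gen //.
have /(_ w)[_ ->] := lspan_lcoef hb (C := setT) Logic.I (fun _ _ _ _ => Logic.I)
    (fun v => @proj1 (I v) (l v < l u)%N) (beta_triangular Iu).
  by rewrite add0r; case: eqP; rewrite ?rmorph1 ?rmorph0.
by move=> [_]; rewrite lw ltnNge -ltnS lu.
Qed.

(** The coefficients at the longest elements are themselves bar-invariant, by
unitriangularity, and in q Z[q] this forces them to vanish. *)
Lemma bar_invariant_eq0 n x : lspan qAplus (below n) b x -> beta x = x -> x = 0.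
Proof.
have sub m : below m `<=` I by move=> w [].
elim: n x => [|n IH] x hx bx; first by case: hx => // a w y _ [].
have coefx w := lspan_lcoef hb qAplus0 qAplusD (@sub _) hx w.
apply: IH => //; apply: (lspan_of_lcoef (hb := hb)) => w; first by case: (coefx w).
move=> nw; have [[Iw lw]|nw'] := pselect (below n.+1 w); last by case: (coefx w) => _ ->.
have eln : l w = n.
  by apply/eqP; rewrite eqn_leq -ltnS lw leqNgt; apply/negP => lt; apply: nw.
have e : lcoef hb x w = laurent_bar (lcoef hb x w).
  rewrite -(@coef_beta n) ?bx //.
  by apply: lspan_mono hx.
by apply: qAplus_bar => //; case: (coefx w).
Qed.

End Bar.
End OneModule.

Section TwoModules.
Context {W : groupType} {S : set W} (hS : coxeter_system S) {J I : set W}.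
Context {M M' : lmodType (hecke S)} {b : W -> M} {b' : W -> M'}.
Context (hM : wgraph_ideal_module J I b) (hM' : wgraph_ideal_module J I b').
Local Notation l := (cox_length S).
Local Notation inv := (@inversion W S).
Local Notation DJ := (min_coset_reps S J).
Local Notation qq := ((q - qinv)%:A).
Local Notation below := (@below W S I).

Section Comparison.
Context {f : M -> M'} (lf : laurent_linear f) (fb : forall w, I w -> f (b w) = b' w).
Context {beta : M -> M}.
Context (betaD : forall x y, beta (x + y) = beta x + beta y).
Context (betaZ : forall (a : laurent) x, beta (a%:A *: x) = (laurent_bar a)%:A *: beta x).
Context (beta1 : beta (b 1%g) = b 1%g).
Context (betaH : forall h x, beta (h *: x) = hecke_bar h *: beta x).
Context {beta' : M' -> M'}.
Context (betaD' : forall x y, beta' (x + y) = beta' x + beta' y).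
Context (betaZ' : forall (a : laurent) x, beta' (a%:A *: x) = (laurent_bar a)%:A *: beta' x).
Context (beta1' : beta' (b' 1%g) = b' 1%g).
Context (betaH' : forall h x, beta' (h *: x) = hecke_bar h *: beta' x).

(** Linearity over H of the map matching the bases, up to length n; it is proved
by induction on n. *)
Definition gen_linear_below n := forall x (s : S), lspan setT (below n) b x ->
  f (hecke_gen s *: x) = hecke_gen s *: f x.

(** Conjugates of basis elements are computed by the T_s on shorter elements, so
the map respects the involutions one step beyond the range of linearity. *)
Lemma bar_linear_below n : gen_linear_below n -> forall x,
  lspan setT (below n.+1) b x -> f (beta x) = beta' (f x).
Proof.
move=> lin x; elim=> [|a w {}x _ [Iw lw] _ IH].
  by rewrite (beta0 betaZ) (laurent_linear0 lf) (beta0 betaZ').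
rewrite betaD betaZ !lf.1 !lf.2 betaD' betaZ' IH; congr (_ *: _ + _).
rewrite fb //; move: w Iw lw; apply: (ideal_ind hS hM) => [|s v Iv Isv asc lsv IHv].
  by rewrite beta1 beta1' fb //; exact: (wgi_one hM).
rewrite lsv => lv; have {}IHv := IHv (ltnW lv).
rewrite -(rule_ascent hS hM Iv asc Isv) -(rule_ascent hS hM' Iv asc Isv).
rewrite (beta_gen betaH) (beta_gen betaH') laurent_linearB // lf.2 -IHv lin //.
rewrite -(subrK (b v) (beta (b v))); apply: lspanD.
  have lv' : (l v <= n)%N := ltnW lv.
  exact: lspan_below_mono lv' (beta_triangular hS hM beta1 betaH Iv).
by apply: lspan_gen; split.
Qed.

(** The first three rules have the same coefficients in both modules.  For a weak
ascent, the difference of the two combinations X is bar-invariant. *)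
Lemma gen_linear_below_step n : gen_linear_below n -> gen_linear_below n.+1.
Proof.
move=> lin x s; elim=> [|a w {}x _ [Iw lw] _ IH].
  by rewrite !(scaler0, laurent_linear0 lf).
rewrite scalerDr scale_laurentC !lf.1 !lf.2 IH scalerDr scale_laurentC fb //; congr (_ *: _ + _).
have [lt|ge] := ltnP (l w) n.
  by rewrite lin ?fb //; apply: lspan_gen.
have [iws|iws] := boolP (inv w (val s)).
  rewrite (rule_descent hS hM) // (rule_descent hS hM') // lf.1 lf.2 !fb //.
  exact: (ideal_descent hS hM).
have [Isw|nIsw] := pselect (I (val s * w)%g).
  by rewrite (rule_ascent hS hM) // (rule_ascent hS hM') // fb.
have [Dsw|nDsw] := pselect (DJ (val s * w)%g); last first.
  rewrite (rule_weak_descent hS hM) // (rule_weak_descent hS hM') //.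
  by rewrite laurent_linearN // lf.2 fb.
have eln : l w = n by apply/eqP; rewrite eqn_leq ge -ltnS lw.
have [X hX eX] := rule_weak_ascent hS hM Iw iws Dsw nIsw.
have [X' hX' eX'] := rule_weak_ascent hS hM' Iw iws Dsw nIsw.
rewrite eln in hX hX'.
suff e : f X - X' = 0.
  by rewrite eX eX' laurent_linearB // lf.2 fb // (subr0_eq e).
have hfX : lspan qAplus (below n.+1) b' (f X).
  by apply: lspan_linear hX => // v [Iv _]; exact: fb.
apply: (bar_invariant_eq0 hS hM' betaD' betaZ' beta1' betaH' (n := n.+1)).
  by apply: lspanD => //; apply: lspanN => //; exact: qAplusN.
(* In both modules, applying the bar involution to T_s b = q b - X gives
X - bar X = (T_s - q) (bar b - b), where bar b - b has lower terms only. *)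
have barX (N : lmodType (hecke S)) (g : N -> N) (y Y : N) :
    (forall x y, g (x + y) = g x + g y) ->
    (forall (a : laurent) x, g (a%:A *: x) = (laurent_bar a)%:A *: g x) ->
    (forall h x, g (h *: x) = hecke_bar h *: g x) ->
    hecke_gen s *: y = q%:A *: y - Y ->
    g Y = Y - (hecke_gen s *: (g y - y) - q%:A *: (g y - y)).
  move=> gD gZ gH e; have gN z : g (- z) = - g z.
    by rewrite -scaleN1r -[-1]scaleN1r gZ rmorphN rmorph1 !scaleN1r.
  have := congr1 g e; rewrite (beta_gen gH) (gD (q%:A *: y)) (gN Y) (gZ q y) bar_q => eg.
  have -> : g Y = qinv%:A *: g y - (hecke_gen s *: g y - qq *: g y).
    by rewrite eg opprB addrCA subrr addr0.
  have -> : qinv%:A *: g y - (hecke_gen s *: g y - qq *: g y) =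
      q%:A *: g y - hecke_gen s *: g y.
    by rewrite opprB addrA -scalerDl -scalerDl [qinv + _]addrC subrK.
  have shuffle (u v z : N) : v - u = Y - (u - (z - Y) - (v - z)).
    by rewrite opprB opprB !addrA subrK [Y + v]addrC addrK.
  by rewrite !scalerBr e.
have gB : forall x y, beta' (x - y) = beta' x - beta' y.
  by move=> u v; rewrite betaD' -scaleN1r -[-1]scaleN1r betaZ' rmorphN rmorph1 !scaleN1r.
have low := beta_triangular hS hM beta1 betaH Iw.
rewrite eln in low; set u := beta (b w) - b w in low.
have fu : f u = beta' (b' w) - b' w.
  rewrite (laurent_linearB _ _ lf) fb // (bar_linear_below lin) ?fb //.
  exact: lspan_gen.
have e1 : beta' (f X) = f X - (hecke_gen s *: f u - q%:A *: f u).
  rewrite -(bar_linear_below lin); last by apply: lspan_mono hX.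
  rewrite (barX _ beta _ X betaD betaZ betaH eX) -/u (laurent_linearB X _ lf).
  by rewrite (laurent_linearB (hecke_gen s *: u) _ lf) (lf.2 q u) lin.
have e2 : beta' X' = X' - (hecke_gen s *: f u - q%:A *: f u).
  by rewrite fu; exact: (barX _ beta' _ X' betaD' betaZ' betaH' eX').
rewrite gB e1 e2; move: (hecke_gen s *: f u - _) => z.
by rewrite opprB addrA subrK.
Qed.

Lemma hecke_linear h x : f (h *: x) = h *: f x.
Proof.
have lin n : gen_linear_below n.
  elim: n => [|n IH]; last exact: gen_linear_below_step.
  move=> {}x s; case=> [|a w y _ []//].
  by rewrite !(scaler0, laurent_linear0 lf).
have gen s y : f (hecke_gen s *: y) = hecke_gen s *: f y.
  elim: (basis_lspan (wgi_basis hM) y) => [|a w z _ Iw _ IH].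
    by rewrite !(scaler0, laurent_linear0 lf).
  rewrite scalerDr !lf.1 scalerDr IH; congr (_ + _).
  by apply: (lin (l w).+1); apply: lspan1 => //; split.
elim/(@hecke_ind W S): h x => [|h k IHh IHk|a h IHh|s h IHh] x.
- by rewrite !scale1r.
- by rewrite !scalerDl lf.1 IHh IHk.
- by rewrite (scale_laurentl h) lf.2 IHh -scale_laurentl.
- by rewrite -!scalerA gen IHh.
Qed.

End Comparison.

(** The map matching the two bases is linear over H, and so is its inverse, which
is the same construction with the modules interchanged. *)
Lemma wgraph_module_iso : exists f : {linear M -> M'}, bijective f.
Proof.
have [f [lf fb]] := basis_map b' (wgi_basis hM).
have [g [lg gb]] := basis_map b (wgi_basis hM').
have [beta [bD bZ _ b1 bH]] := wgi_bar hM.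
have [beta' [bD' bZ' _ b1' bH']] := wgi_bar hM'.
have fH := hecke_linear lf fb bD bZ b1 bH bD' bZ' b1' bH'.
have flin : linear f by move=> h x y; rewrite lf.1 fH.
pose F : {linear M -> M'} := HB.pack f (GRing.isLinear.Build _ _ _ _ f flin).
exists F; exists g => x /=.
  elim: (basis_lspan (wgi_basis hM) x) => [|a w y _ Iw _ IH].
    by rewrite (laurent_linear0 lf) (laurent_linear0 lg).
  by rewrite lf.1 lf.2 lg.1 lg.2 IH fb // gb.
elim: (basis_lspan (wgi_basis hM') x) => [|a w y _ Iw _ IH].
  by rewrite (laurent_linear0 lg) (laurent_linear0 lf).
by rewrite lg.1 lg.2 lf.1 lf.2 IH gb // fb.
Qed.

End TwoModules.

(** * The induced module *)

Section BarInvolution.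

Lemma laurent_barK : involutive laurent_bar.
Proof.
move=> a; have [[n p] /= ap] := laurentP a.
have barq : laurent_bar (laurent_bar q) = q by rewrite bar_q bar_qinv.
pose f : {rmorphism laurent -> laurent} := laurent_bar \o laurent_bar.
have barp : f (poly_laurent p) = poly_laurent p.
  rewrite -(coefK p) poly_def (rmorph_sum poly_laurent) (rmorph_sum f).
  apply: eq_bigr => i _; transitivity (f ((p`_i)%:~R * q ^+ i)).
    by congr (f _); exact: poly_laurentZX.
  rewrite (rmorphM f) rmorph_int (rmorphXn f).
  by rewrite -[f q]/(laurent_bar (laurent_bar q)) barq; exact/esym/poly_laurentZX.
have : f a * q ^+ n = a * q ^+ n.
  have fq : f q = q := barq.
  by rewrite -[in LHS]fq -(rmorphXn f) -(rmorphM f) ap barp.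
move=> /(congr1 ( *%R^~ (qinv ^+ n))).
by rewrite -!mulrA -exprMn mulqV expr1n !mulr1.
Qed.

Lemma hecke_barK (W : groupType) (S : set W) : involutive (@hecke_bar W S).
Proof.
apply: (@hecke_rmorph_ext _ _ _ (hecke_bar (S := S) \o hecke_bar (S := S)) idfun) => [a|s] /=.
  by rewrite !hecke_bar_scale laurent_barK.
rewrite hecke_bar_gen rmorphB /= hecke_bar_gen hecke_bar_scale rmorphB /=.
by rewrite bar_q bar_qinv -addrA -opprD -scalerDl addrC subrKA subrr scale0r oppr0 add0r.
Qed.

Lemma hecke_bar_incl (W : groupType) (K S : set W) (KS : K `<=` S) (k : hecke K) :
  hecke_bar (hecke_incl KS k) = hecke_incl KS (hecke_bar k).
Proof.
move: k; apply: (@hecke_rmorph_ext _ _ _ (hecke_bar (S := S) \o hecke_incl KS)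
  (hecke_incl KS \o hecke_bar (S := K))) => [a|s] /=.
  by rewrite hecke_incl_scale !hecke_bar_scale hecke_incl_scale.
rewrite hecke_incl_gen !hecke_bar_gen rmorphB /= hecke_incl_gen.
by rewrite hecke_incl_scale.
Qed.

End BarInvolution.

Section Induced.
Context {W : groupType} {S : set W} (hS : coxeter_system S).
Context {K : set W} (KS : K `<=` S) {J I0 : set W}.
Context {M : lmodType (hecke K)} {b0 : W -> M} (hM : wgraph_ideal_module J I0 b0).
Implicit Types (d w z t : W).
Local Notation l := (cox_length S).
Local Notation inv := (@inversion W S).
Local Notation WK := (gen_subgroup K).
Local Notation D := (min_coset_reps S K).
Local Notation incl := (hecke_incl KS).
Local Notation T := (tensor incl M).
Local Notation pure := (pure_tensor incl).
Local Notation hb0 := (wgi_basis hM).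
Local Notation I := [set (d * z)%g | d in D & z in I0].

Let I0K z : I0 z -> WK z.
Proof. by have [h _] := wgi_ideal hM; exact: h. Qed.

Let JK s : J s -> K s.
Proof. exact: (wgi_sub hM). Qed.

Let I0_descent z t : I0 z -> K t -> inv z t -> I0 (t * z)%g.
Proof.
move=> Iz ht inv; have [_ h] := wgi_ideal hM; apply: (h _ _ Iz).
by apply: (suffix_descent hS KS) => //; exact: I0K.
Qed.

Lemma induced_mem d z : D d -> WK z -> I (d * z)%g <-> I0 z.
Proof.
move=> hd hz; split=> [[d' hd' [z' Iz' e]]|Iz]; last by exists d => //; exists z.
have [_ <-] := coset_decomp_uniq hS KS hd' hd (I0K Iz') hz e.
exact: Iz'.
Qed.

Lemma min_rep_reps d (y : W) : D d -> WK y ->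
  min_coset_reps S J (d * y)%g <-> min_coset_reps K J y.
Proof.
move=> hd hy; have hyj j : J j -> WK (y * j)%g.
  by move=> /JK hj; exact/gen_subM/gen_sub_gen.
have len j : J j -> (l (d * y)%g < l (d * y * j)%g)%N = (cox_length K y < cox_length K (y * j)%g)%N.
  move=> /hyj hj; rewrite -mulgA (min_rep_length hS KS hd hy) (min_rep_length hS KS hd hj).
  by rewrite ltn_add2l !(gen_length hS KS).
split=> -[_ h]; split=> //; try exact: gen_subgroupT; move=> j hj.
  by rewrite -len // h.
by rewrite len // h.
Qed.

Lemma inversion_min_rep_in d z (s : W) : D d -> WK z -> S s -> D (s * d)%g ->
  inv (d * z)%g s = inv d s.
Proof.
move=> hd hz hs hsd; rewrite !(inversionP hS) // mulgA.
by rewrite (min_rep_length hS KS hd hz) (min_rep_length hS KS hsd hz) ltn_add2r.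
Qed.

Lemma inversion_min_rep_out d z (s t : W) : D d -> WK z -> S s -> K t ->
  (s * d = d * t)%g -> inv (d * z)%g s = inv z t.
Proof.
move=> hd hz hs ht e; have htz := gen_subM (gen_sub_gen ht) hz.
rewrite (inversionP hS _ hs) (inversionP hS _ (KS ht)) mulgA e -mulgA.
by rewrite (min_rep_length hS KS hd hz) (min_rep_length hS KS hd htz) ltn_add2l.
Qed.

(** The factors in W = D_K W_K, which exist and are unique. *)
Definition coset_parts w : W * W :=
  xget (1%g, 1%g) [set p | [/\ D p.1, WK p.2 & w = (p.1 * p.2)%g]].

Definition induced_basis w : T :=
  pure (Tstd S (coset_parts w).1) (b0 (coset_parts w).2).

Lemma induced_basisE d z : D d -> WK z ->
  induced_basis (d * z)%g = pure (Tstd S d) (b0 z).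
Proof.
move=> hd hz; rewrite /induced_basis /coset_parts; case: xgetP => [[d' z'] _ []|].
  by move=> /= hd' hz' /(coset_decomp_uniq hS KS hd hd' hz hz')[-> ->].
by move=> /(_ (d, z))[].
Qed.

Lemma Tgen_min_rep_in_descent d (s : W) (x : M) : D d -> S s -> inv d s ->
  Tgen s *: pure (Tstd S d) x = pure (Tstd S (s * d)%g) x + (q - qinv)%:A *: pure (Tstd S d) x.
Proof.
move=> hd hs desc; rewrite !scale_pure_tensor -pure_tensorDl.
by rewrite (Tgen_descent hS) ?mulr_algl //; exact: gen_subgroupT.
Qed.

Lemma Tgen_min_rep_in_ascent d (s : W) (x : M) : D d -> S s -> ~~ inv d s ->
  Tgen s *: pure (Tstd S d) x = pure (Tstd S (s * d)%g) x.
Proof.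
move=> hd hs asc; rewrite scale_pure_tensor.
by rewrite (Tgen_ascent hS) //; exact: gen_subgroupT.
Qed.

(** As lengths add in d t, T_s T_d = T_sd = T_dt = T_d T_t, and T_t moves across
the tensor sign. *)
Lemma Tgen_min_rep_out d (s t : W) (x : M) : D d -> S s -> K t -> (s * d = d * t)%g ->
  Tgen s *: pure (Tstd S d) x = pure (Tstd S d) (Tgen t *: x).
Proof.
move=> hd hs ht e; have ht' := gen_sub_gen ht; have hSt := KS ht.
have asc : ~~ inv d s.
  rewrite (ascentP hS) // e (min_rep_length hS KS) // (length_gen hS hSt) addn1 //.
have eT : Tstd S (d * t)%g = Tstd S d * Tstd S t :> hecke S.
  apply: (Tstd_mul hS) => //; try exact: gen_subgroupT.
  exact: (min_rep_length hS KS).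
rewrite Tgen_min_rep_in_ascent // e eT.
have -> : Tstd S t = incl (Tgen t) by rewrite incl_Tgen // (Tstd_gen hS).
exact: pure_tensorM.
Qed.

Lemma pure_laurent_linear (h : hecke S) : laurent_linear (pure h : M -> T).
Proof.
split=> [x y|a x]; first exact: pure_tensorDr.
rewrite -pure_tensorM /= hecke_incl_scale scale_pure_tensor.
by rewrite mulr_algl mulr_algr.
Qed.

Lemma lspan_min_rep C A A0 d x : D d -> A0 `<=` I0 -> (forall y, A0 y -> A (d * y)%g) ->
  lspan C A0 b0 x -> lspan C A induced_basis (pure (Tstd S d) x).
Proof.
move=> hd AI dA hx; apply: (lspan_reindex (f := mulg d) dA).
apply: lspan_linear (pure_laurent_linear _) _ hx => y /AI Iy.
by rewrite /= induced_basisE //; exact: I0K.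
Qed.

(** The span contains 1 (x) m and is stable under the T_s. *)
Lemma induced_spans (x : T) : lspan setT I induced_basis x.
Proof.
have coset d m : D d -> lspan setT I induced_basis (pure (Tstd S d) m).
  move=> hd; apply: lspan_min_rep (basis_lspan hb0 m) => // y Iy.
  by apply/induced_mem => //; exact: I0K.
have gen (s : S) y : lspan setT I induced_basis y ->
    lspan setT I induced_basis (hecke_gen s *: y).
  elim=> [|a w {}y _ [d hd [z Iz <-]] _ IH]; first by rewrite scaler0; exact: lspan0.
  rewrite scalerDr scale_laurentC; apply: lspanD => //; apply: lspanZ.
  have hs := set_valP s; rewrite (induced_basisE hd (I0K Iz)) -Tgen_val.
  have [hsd|[t ht e]] := deodhar hS KS hd hs; last by rewrite (Tgen_min_rep_out _ hd hs ht e); exact: coset.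
  have [desc|asc] := boolP (inv d (val s)).
    by rewrite Tgen_min_rep_in_descent //; apply: lspanD; [|apply: lspanZ]; exact: coset.
  by rewrite Tgen_min_rep_in_ascent //; exact: coset.
elim/(@tensor_ind _ _ incl M): x => [h m|x y]; last exact: lspanD.
elim/(@hecke_ind W S): h => [|h k IHh IHk|a h IHh|s h IHh].
- by rewrite -(Tstd1 hS (K := S)) //; apply: coset; exact: (min_rep1 hS).
- by rewrite pure_tensorDl; exact: lspanD.
- by rewrite -mulr_algl -scale_pure_tensor; exact: lspanZ.
- by rewrite -scale_pure_tensor; exact: gen.
Qed.

(** The coordinate at d z is that at z of the component along T_d. *)
Lemma induced_laurent_basis : laurent_basis I induced_basis.
Proof.
apply: basis_of_forms => [|_ [d hd [z Iz <-]]]; first exact: induced_spans.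
exists (fun x => lcoef hb0 (tensor_component hS d x) z); split=> [x y|a x|_ [d' hd' [z' Iz' <-]]].
- by rewrite tensor_componentD // lcoefD.
- by rewrite tensor_componentZ // lcoefZ.
have [hz hz'] := (I0K Iz, I0K Iz').
rewrite induced_basisE // tensor_component_std //.
case: eqVneq => [<-|nd]; first by rewrite lcoef_gen // (inj_eq (mulgI d)) eq_sym.
rewrite lcoef0; case: eqP => // e; case/eqP: nd.
by have [] := coset_decomp_uniq hS KS hd' hd hz' hz e.
Qed.

Lemma induced_descent w (s : W) : I w -> S s -> inv w s -> I (s * w)%g.
Proof.
move=> [d hd [z Iz <-]] hs; have hz := I0K Iz.
have [hsd _|[t ht e]] := deodhar hS KS hd hs; first by rewrite mulgA; exists (s * d)%g => //; exists z.
rewrite (inversion_min_rep_out hd hz hs ht e) => desc.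
rewrite mulgA e -mulgA; exists d => //; exists (t * z)%g => //.
exact: I0_descent.
Qed.

(** Suffixes are obtained by removing left descents one at a time. *)
Lemma induced_left_ideal : left_ideal S I.
Proof.
split=> [w _|u w Iw [_ _]]; first exact: gen_subgroupT.
have [a [ha sa ex]] := lengthP hS (w * u^-1)%g; rewrite -{}sa => lw.
have {ex} ew : w = (wprod a * u)%g by rewrite -ex mulgVK.
rewrite {}ew in Iw lw; elim: a ha Iw lw => [|s a IH]; first by rewrite wprod_nil mul1g.
move=> /word_cons[hs ha]; rewrite wprod_cons -mulgA => Iw lw.
have e : (s * (s * (wprod a * u)) = wprod a * u)%g by rewrite mulgA (gen_sqr hS) // mul1g.
have desc : inv (s * (wprod a * u))%g s.
  rewrite (inversionP hS) // e -lw /= addSn ltnS (leq_trans (lengthM hS _ _)) //.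
  by rewrite leq_add2r length_le.
apply: IH => //; first by rewrite -e; exact: induced_descent.
by apply/eqP; rewrite -eqSS -addSn lw -[in X in _ == X]e -(length_descent hS hs desc).
Qed.

Lemma induced_reps : I `<=` min_coset_reps S J.
Proof.
move=> _ [d hd [z Iz <-]]; apply/(min_rep_reps hd (I0K Iz)); exact: (wgi_reps hM).
Qed.

(** If s d is in D_K then s d z is in I, so s is a strong ascent or descent.
Otherwise s d = d t, and s has for d z the type that t has for z. *)
Lemma induced_rules : hecke_action_rules J I induced_basis.
Proof.
move=> s _ [d hd [z Iz <-]]; have [hs hz] := (set_valP s, I0K Iz).
rewrite induced_basisE // -Tgen_val.
have [hsd|[t ht e]] := deodhar hS KS hd hs.
  have Isw : I (val s * (d * z))%g by rewrite mulgA; exists (val s * d)%g => //; exists z.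
  have ebT : induced_basis (val s * (d * z))%g = pure (Tstd S (val s * d)%g) (b0 z).
    by rewrite mulgA induced_basisE.
  split.
  - move=> [_ /(bruhat_ascentE hS _ hs) asc _]; rewrite ebT Tgen_min_rep_in_ascent //.
    by rewrite -(inversion_min_rep_in hd hz hs hsd).
  - move=> [_ /(bruhat_descentE hS _ hs) desc]; rewrite ebT Tgen_min_rep_in_descent //.
    by rewrite -(inversion_min_rep_in hd hz hs hsd).
  - by move=> [_ _ []]; exact: induced_reps.
  - by move=> [_ _ [_ []]].
have htz := gen_subM (gen_sub_gen ht) hz.
have esw : (val s * (d * z) = d * (t * z))%g by rewrite !mulgA e.
have einv := inversion_min_rep_out hd hz hs ht e.
have [t' [et' eT]] := TgenE ht.
have [SA SD WD WA] := wgi_rules hM t' Iz; rewrite et' in SA SD WD WA.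
rewrite esw (Tgen_min_rep_out _ hd hs ht e) eT.
have bE : induced_basis (d * (t * z))%g = pure (Tstd S d) (b0 (t * z)%g) by exact: induced_basisE.
have [fD fZ] := pure_laurent_linear (Tstd S d).
have lf := pure_laurent_linear (Tstd S d).
have asc0 : bruhat_lt S (d * z)%g (val s * (d * z))%g -> bruhat_lt K z (t * z)%g.
  move=> /(bruhat_ascentE hS _ hs); rewrite einv.
  exact: (bruhat_lt_ascent hS KS hz ht).
split.
- move=> [_ /asc0 asc]; rewrite esw => /(induced_mem hd htz) Itz.
  by rewrite bE SA.
- move=> [_ /(bruhat_descentE hS _ hs)]; rewrite einv => desc.
  rewrite bE SD ?fD ?fZ //; split=> //.
  exact: (bruhat_lt_descent hS KS hz ht desc).
- move=> [_ /asc0 asc]; rewrite esw => nD.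
  rewrite WD; first by rewrite (laurent_linearN _ lf) fZ.
  by split=> // Dtz; apply: nD; apply/(min_rep_reps hd htz).
move=> [_ /asc0 asc]; rewrite esw => -[/(min_rep_reps hd htz) Dtz nI].
have [|r [rq ->]] := WA.
  by split=> //; split=> // Itz; apply: nI; apply/(induced_mem hd htz).
rewrite (laurent_linearB _ _ lf) fZ.
set A0 : set W := [set y | I0 y /\ bruhat_lt K y (t * z)%g].
set A : set W := [set y | I y /\ bruhat_lt S y (d * (t * z))%g].
have /(lspan_fsumP qAplus0 qAplusD)[c [cq ->]] : lspan qAplus A induced_basis
    (pure (Tstd S d) (\sum_(y \in A0) (r y)%:A *: b0 y)).
  apply: lspan_min_rep (lspan_fsum A0 b0 rq) => // [y []//|y [Iy lt]].
  split; first by apply/(induced_mem hd (I0K Iy)).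
  exact: (bruhat_lt_min_rep hS KS).
by exists c.
Qed.

Lemma induced_bar : has_bar_involution (M := T) induced_basis.
Proof.
have [beta0 [bD bZ bK b1 bH]] := wgi_bar hM.
pose f (h : hecke S) (m : M) : T := pure (hecke_bar h) (beta0 m).
have fDl h k m : f (h + k) m = f h m + f k m by rewrite /f rmorphD pure_tensorDl.
have fDr h m n : f h (m + n) = f h m + f h n by rewrite /f bD pure_tensorDr.
have fM h k m : f (h * incl k) m = f h (k *: m).
  by rewrite /f bH -pure_tensorM rmorphM; congr (pure (_ * _) _); exact: hecke_bar_incl.
pose beta : T -> T := tensor_lift f.
have betaD := tensor_liftD fDl fDr fM.
have betaE := tensor_lift_pure fDl fDr fM.
have betaH h x : beta (h *: x) = hecke_bar h *: beta x.
  elim/(@tensor_ind _ _ incl M): x => [k m|x y IHx IHy].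
    by rewrite scale_pure_tensor /beta !betaE /f rmorphM scale_pure_tensor.
  by rewrite scalerDr /beta !betaD scalerDr -/beta IHx IHy.
exists beta; split=> //.
- by move=> a x; rewrite betaH hecke_bar_scale.
- elim/(@tensor_ind _ _ incl M) => [k m|x y IHx IHy].
    by rewrite /beta !betaE /f hecke_barK bK.
  by rewrite /beta !betaD -/beta IHx IHy.
rewrite -[1%g](mulg1 1%g) induced_basisE; last exact: gen_sub1.
  by rewrite (Tstd1 hS) // /beta betaE /f rmorph1 b1.
exact: (min_rep1 hS).
Qed.

Lemma induced_wgraph_ideal_module : wgraph_ideal_module J I induced_basis.
Proof.
split.
- by move=> s /JK /KS.
- exact: induced_left_ideal.
- exists 1%g; first exact: (min_rep1 hS).
  by exists 1%g; rewrite ?mulg1 //; exact: (wgi_one hM).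
- exact: induced_reps.
- exact: induced_laurent_basis.
- exact: induced_rules.
- exact: induced_bar.
Qed.

End Induced.

Theorem theorem9p2 (W : groupType) (S K J I0 : set W)
    (hS : coxeter_system S) (hKS : K `<=` S)
    (S0 : lmodType (hecke K)) (b0 : W -> S0)
    (hI0 : wgraph_ideal_module J I0 b0) :
  let I := [set (d * z)%g | d in min_coset_reps S K & z in I0] in
  wgraph_ideal S J I /\
  forall (M : lmodType (hecke S)) (b : W -> M), wgraph_ideal_module J I b ->
    exists f : {linear M -> tensor (hecke_incl hKS) S0}, bijective f.
Proof.
move=> I; have hT := induced_wgraph_ideal_module hS hKS hI0.
split; first by exists (tensor (hecke_incl hKS) S0), (induced_basis (S := S) hKS (b0 := b0)).
by move=> M b hM; exact: (wgraph_module_iso hS hM hT).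
Qed.
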